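(* Let $c_1,c_2,k_1,k_2>0$ and set $$a_{11}=-2k_1c_1(c_1+c_2),\quad a_{12}=-k_1(c_1^2-c_2^2),\quad a_{21}=k_2(c_1^2-c_2^2),\quad a_{22}=-2k_2c_2(c_1+c_2).$$ Let $b_{11},b_{12},b_{21},b_{22}\in\mathbb{R}$ satisfy $a_{12}+b_{11}b_{12}\neq 0$, and put $$A_1=\frac{a_{21}+b_{21}b_{22}}{a_{12}+b_{11}b_{12}},\qquad q_1=\Big(a_{11}+\tfrac12 b_{11}^2\Big)A_1-\tfrac12 b_{21}^2,\qquad q_2=-a_{22}-\tfrac12 b_{22}^2+\tfrac12 b_{12}^2A_1 .$$ If $A_1<0$, $q_1>0$ and $q_2>0$, then the trivial solution $u\equiv 0$ of the linear It\^o stochastic differential system $$\begin{aligned} du_1(t)&=(a_{11}u_1(t)+a_{12}u_2(t))\,dt+(b_{11}u_1(t)+b_{12}u_2(t))\,dB(t),\\ du_2(t)&=(a_{21}u_1(t)+a_{22}u_2(t))\,dt+(b_{21}u_1(t)+b_{22}u_2(t))\,dB(t),\end{aligned}$$ is mean square stable.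
   Context: $B(t)$, $t\ge 0$, is a standard one-dimensional Wiener process on a filtered probability space (the same process drives both equations), and the equations are understood in the It\^o sense. The system is the linearization of the stochastic Cournot duopoly game $$dx_1=k_1\Big(\frac{x_2}{(x_1+x_2)^2}-c_1\Big)dt+(b_{11}x_1+b_{12}x_2+\gamma_1)\,dB,\qquad dx_2=k_2\Big(\frac{x_1}{(x_1+x_2)^2}-c_2\Big)dt+(b_{21}x_1+b_{22}x_2+\gamma_2)\,dB,$$ with $\gamma_1=-\frac{b_{11}c_2+b_{12}c_1}{(c_1+c_2)^2}$ and $\gamma_2=-\frac{b_{21}c_2+b_{22}c_1}{(c_1+c_2)^2}$, at its stationary state $\big(\frac{c_2}{(c_1+c_2)^2},\frac{c_1}{(c_1+c_2)^2}\big)$; the numbers $a_{ij}$ are the entries of the Jacobian matrix of the drift there. Mean square stability of the trivial solution means: for every $\varepsilon>0$ there is $\delta>0$ such that every solution $u=(u_1,u_2)$ whose initial value $u(0)$ is square-integrable, independent of $B$, and satisfies $E\|u(0)\|^2<\delta$ has $E\|u(t)\|^2<\varepsilon$ for all $t\ge 0$. *)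

(* Defs.v *)
(* MathComp-Analysis. *)
From HB Require Import structures.
From mathcomp Require Import all_boot all_order all_algebra.
From mathcomp Require Import all_classical all_reals all_analysis.

Set Implicit Arguments.
Unset Strict Implicit.
Unset Printing Implicit Defensive.

Import Order.TTheory GRing.Theory Num.Theory.
Import numFieldNormedType.Exports.

Local Open Scope classical_set_scope.
Local Open Scope ring_scope.

(* A stochastic process indexed by [0, +oo[ is a function R -> T -> R; its
   values at negative times are junk and are never constrained. *)

Record filtration (R : realType) (d : measure_display) (T : measurableType d) :=
  Filtration {
  filt :> R -> set (set T) ;
  filt_sigma_algebra : forall t : R, 0 <= t -> sigma_algebra setT (filt t) ;
  filt_measurable : forall t : R, 0 <= t -> filt t `<=` measurable ;
  filt_mono : forall s t : R, 0 <= s -> s <= t -> filt s `<=` filt t }.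

(* The library's [measurable_fun] speaks of the ambient sigma-algebra of T only,
   hence this version relative to a family G of subsets of T. *)
Definition measurable_wrt (R : realType) (d : measure_display)
    (T : measurableType d) (G : set (set T)) (X : T -> R) : Prop :=
  forall C : set R, measurable C -> G (X @^-1` C).

Definition adapted (R : realType) (d : measure_display) (T : measurableType d)
    (F : filtration R T) (X : R -> T -> R) : Prop :=
  forall t : R, 0 <= t -> measurable_wrt (F t) (X t).

Definition continuous_paths (R : realType) (d : measure_display)
    (T : measurableType d) (P : probability T R) (X : R -> T -> R) : Prop :=
  {ae P, forall w, {within `[0, +oo[, continuous (fun t => X t w)}}.

Definition cvg_in_probability (R : realType) (d : measure_display)
    (T : measurableType d) (P : probability T R)
    (X_ : nat -> T -> \bar R) (X : T -> \bar R) : Prop :=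
  forall e : R, 0 < e ->
    P [set w | (e%:E <= `|X_ n w - X w|)%E] @[n --> \oo] --> 0%E.

(* The second argument of [normal_prob] is the standard deviation. *)
Definition wiener (R : realType) (d : measure_display) (T : measurableType d)
    (P : probability T R) (F : filtration R T) (B : R -> T -> R) : Prop :=
  [/\ adapted F B,
      {ae P, forall w, B 0 w = 0},
      (forall s t : R, 0 <= s -> s < t ->
         forall (A : set T) (C : set R), F s A -> measurable C ->
         P (A `&` (fun w => B t w - B s w)%R @^-1` C) =
         (P A * P ((fun w => B t w - B s w)%R @^-1` C))%E),
      (forall s t : R, 0 <= s -> s < t ->
         forall C : set R, measurable C ->
         P ((fun w => B t w - B s w)%R @^-1` C) = normal_prob 0 (Num.sqrt (t - s)) C) &
      continuous_paths P B].

(* The simple process \sum_(i < n) xi_i 1_(]t_i, t_i.+1]), where xi_i is bounded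
   and F(t_i)-measurable. *)
Record simple_process (R : realType) (d : measure_display)
    (T : measurableType d) (F : filtration R T) := SimpleProcess {
  sp_size : nat ;
  sp_time : nat -> R ;
  sp_coef : nat -> T -> R ;
  sp_time_ge0 : forall i, 0 <= sp_time i ;
  sp_time_homo : {homo sp_time : i j / (i <= j)%N >-> i <= j} ;
  sp_coef_adapted :
    forall i, (i < sp_size)%N -> measurable_wrt (F (sp_time i)) (sp_coef i) ;
  sp_coef_bounded :
    exists M : R, forall i w, (i < sp_size)%N -> `|sp_coef i w| <= M }.

Definition sp_eval (R : realType) (d : measure_display) (T : measurableType d)
    (F : filtration R T) (S : simple_process F) (s : R) (w : T) : R :=
  \sum_(i < sp_size S)
    sp_coef S i w * \1_(`]sp_time S i, sp_time S i.+1]) s.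

(* \int_0^t S dB for a simple process S *)
Definition sp_integral (R : realType) (d : measure_display)
    (T : measurableType d) (F : filtration R T) (B : R -> T -> R)
    (S : simple_process F) (t : R) (w : T) : R :=
  \sum_(i < sp_size S)
    sp_coef S i w *
    (B (Num.min (sp_time S i.+1) t) w - B (Num.min (sp_time S i) t) w).

Definition ito_integrand (R : realType) (d : measure_display)
    (T : measurableType d) (P : probability T R) (F : filtration R T)
    (H : R -> T -> R) : Prop :=
  [/\ measurable_fun [set z : measurableTypeR R * T | 0 <= (z.1 : R)]
        (fun z => H z.1 z.2),
      adapted F H &
      forall t : R, 0 <= t -> {ae P, forall w,
        (\int[lebesgue_measure]_(s in `[0%R, t]) ((H s w) ^+ 2)%:E < +oo)%E}].

(* J is (a version of) \int_0^t H dB: the limit in probability of the integrals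
   of simple processes H_n such that \int_0^t (H_n - H)^2 ds tends to 0 in
   probability. Up to a.s. equality it does not depend on the sequence H_n,
   and no moment condition on H is required. *)
Definition is_ito_integral (R : realType) (d : measure_display)
    (T : measurableType d) (P : probability T R) (F : filtration R T)
    (B : R -> T -> R) (H : R -> T -> R) (t : R) (J : T -> R) : Prop :=
  [/\ ito_integrand P F H,
      measurable_fun setT J &
      exists S_ : nat -> simple_process F,
        cvg_in_probability P
          (fun n w => \int[lebesgue_measure]_(s in `[0%R, t])
                        ((sp_eval (S_ n) s w - H s w) ^+ 2)%:E)%E
          (cst 0%E) /\
        cvg_in_probability P
          (fun n w => (sp_integral B (S_ n) t w)%:E) (fun w => (J w)%:E)].

(* u = (u1, u2) is a solution of the autonomous Ito system
   du_i = f_i(u1, u2) dt + g_i(u1, u2) dB, i = 1, 2, on [0, +oo[. *)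
Definition ito_solution (R : realType) (d : measure_display)
    (T : measurableType d) (P : probability T R) (F : filtration R T)
    (B : R -> T -> R) (f1 f2 g1 g2 : R -> R -> R) (u1 u2 : R -> T -> R) : Prop :=
  [/\ adapted F u1 /\ adapted F u2,
      continuous_paths P u1 /\ continuous_paths P u2 &
      forall t : R, 0 <= t -> exists J1 J2 : T -> R,
        [/\ is_ito_integral P F B (fun s w => g1 (u1 s w) (u2 s w)) t J1,
            is_ito_integral P F B (fun s w => g2 (u1 s w) (u2 s w)) t J2,
            {ae P, forall w, u1 t w = u1 0 w +
              \int[lebesgue_measure]_(s in `[0%R, t]) f1 (u1 s w) (u2 s w) + J1 w} &
            {ae P, forall w, u2 t w = u2 0 w +
              \int[lebesgue_measure]_(s in `[0%R, t]) f2 (u1 s w) (u2 s w) + J2 w}]].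

Definition process_sigma (R : realType) (d : measure_display)
    (T : measurableType d) (B : R -> T -> R) : set (set T) :=
  <<s [set A | exists (t : R) (C : set R),
         [/\ 0 <= t, measurable C & A = B t @^-1` C]] >>.

Definition pair_independent_of (R : realType) (d : measure_display)
    (T : measurableType d) (P : probability T R) (X Y : T -> R)
    (B : R -> T -> R) : Prop :=
  forall (D : set (measurableTypeR R * measurableTypeR R)) (A : set T),
    measurable D -> process_sigma B A ->
    P ((fun w => (X w, Y w)) @^-1` D `&` A) =
    (P ((fun w => (X w, Y w)) @^-1` D) * P A)%E.

(* E ||(X, Y)||^2 for the Euclidean norm, possibly +oo *)
Definition mean_square (R : realType) (d : measure_display)
    (T : measurableType d) (P : probability T R) (X Y : T -> R) : \bar R :=
  ('E_P[(fun w => X w ^+ 2 + Y w ^+ 2)%R])%E.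

(* Stability of the trivial solution; f1, f2, g1, g2 are meant to vanish at
   (0, 0). *)
Definition mean_square_stable (R : realType) (d : measure_display)
    (T : measurableType d) (P : probability T R) (F : filtration R T)
    (B : R -> T -> R) (f1 f2 g1 g2 : R -> R -> R) : Prop :=
  forall e : R, 0 < e -> exists2 delta : R, 0 < delta &
    forall u1 u2 : R -> T -> R,
      ito_solution P F B f1 f2 g1 g2 u1 u2 ->
      (mean_square P (u1 0%R) (u2 0%R) < +oo)%E ->
      pair_independent_of P (u1 0) (u2 0) B ->
      (mean_square P (u1 0%R) (u2 0%R) < delta%:E)%E ->
      forall t : R, 0 <= t -> (mean_square P (u1 t) (u2 t) < e%:E)%E.

(* Main.v *)
Require Import Defs.
From mathcomp Require Import all_boot all_order all_algebra.
From mathcomp Require Import all_classical all_reals all_analysis.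
From mathcomp Require Import measurable_realfun ring lra.

Set Implicit Arguments.
Unset Strict Implicit.
Unset Printing Implicit Defensive.

Import Order.TTheory GRing.Theory Num.Theory.
Import numFieldNormedType.Exports.

Local Open Scope classical_set_scope.
Local Open Scope ring_scope.

(* With V(x, y) = - A1 x^2 + y^2 the hypotheses say exactly that the generator
   of the system maps V to - 2 q1 x^2 - 2 q2 y^2 <= 0, so it is enough to prove
   E V(u(t)) <= E V(u(0)). This is obtained without the Ito formula. On a mesh
   of step h, u follows the Euler scheme up to an increment which, off a small
   event, is the sum of a simple stochastic integral with integrand bounded by
   eta and of a remainder bounded by 2 eta h: the first is the integral of a
   simple approximation of the diffusion coefficient, recentred at the left end
   point and truncated at level eta, and the second is truncated as well. The
   scheme driven by these truncated increments therefore coincides with u off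
   the small event, while it is square integrable and satisfies
   E V + 1 <= (1 + C eta h) (E V + 1) at each step. Letting the event and eta
   vanish bounds E min(V(u(t)), c) by E V(u(0)) for every c. *)

(** * Second moments of Gaussian increments *)

Section normal_second_moment.
Context {R : realType}.
Local Notation mu := (@lebesgue_measure R).
Import HBNNSimple.

(** The obstacle is that a solution carries no moment bound at positive times: its stochastic
    integrals are mere limits in probability, and the second moments of the approximating integrals
    are not uniformly controlled, so no isometry passes to the limit. Only statements about paths
    off a small event can be transferred, hence a square integrable object has to be manufactured.
    Truncating adapted quantities keeps them adapted, so the exact isometry over independent
    Gaussian increments applies to the truncated scheme at every step, whatever happens on the bad
    event. Comparing only [min(V, c)] with the scheme costs at most [c] times the probability of
    that event. The order of the choices matters: [eta] is fixed before the mesh, which is then made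
    so fine that paths oscillate little over one step. Terms of order [h] without a factor [eta] add
    up to [h] times the generator, which is nonpositive; the loss over [M / h] steps is therefore at
    most [expR (C * eta * M)], close to 1 for small [eta]. The 1 added to [E V] turns additive
    errors of order [eta h] into multiplicative ones. *)

Lemma ge0_integral_normal_prob (m s : R) (f : measurableTypeR R -> \bar R) :
  measurable_fun setT f -> (forall x, 0 <= f x)%E ->
  (\int[normal_prob m s]_x f x = \int[mu]_x (f x * (normal_pdf m s x)%:E))%E.
Proof.
move=> mf f0.
have mpdf : measurable_fun setT (fun x : measurableTypeR R => (normal_pdf m s x)%:E).
  by apply/measurable_EFinP; exact: measurable_normal_pdf.
have pdf0 x : (0 <= (normal_pdf m s x)%:E)%E by rewrite lee_fin normal_pdf_ge0.
(* On each level set of a simple function, [normal_prob] is by definition the integral of its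
   density; monotone convergence does the rest. *)
have nnE (g : {nnsfun _ >-> R}) : (\int[normal_prob m s]_x (g x)%:E =
    \int[mu]_x ((g x)%:E * (normal_pdf m s x)%:E))%E.
  under [LHS]eq_integral do rewrite fimfunE -fsumEFin//.
  rewrite [LHS]ge0_integral_fsum//; last 2 first.
  - by move=> r; exact/measurable_EFinP/measurableT_comp.
  - by move=> n x _; rewrite EFinM nnfun_muleindic_ge0.
  under [RHS]eq_integral.
    move=> x _; rewrite fimfunE -fsumEFin// muleC ge0_mule_fsumr; last first.
      by move=> r; rewrite EFinM nnfun_muleindic_ge0.
    over.
  rewrite [RHS]ge0_integral_fsum//; last 2 first.
  - move=> r; apply: emeasurable_funM => //.
    by apply/measurable_EFinP; apply: measurable_funM => //; exact: measurable_indic.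
  - by move=> n x _; rewrite mule_ge0// EFinM nnfun_muleindic_ge0.
  apply: eq_fsbigr => r _.
  rewrite integralZl_indic_nnsfun//= integral_indic// setIT.
  under eq_integral do rewrite EFinM muleCA.
  have [r0|r0] := leP 0 r.
    rewrite ge0_integralZl//; last 2 first.
    - by apply: emeasurable_funM => //; apply/measurable_EFinP.
    - by move=> x _; rewrite mule_ge0// lee_fin.
    congr (_ * _)%E; rewrite /normal_prob.
    rewrite [LHS]integral_mkcond/=; apply: eq_integral => x _.
    by rewrite patchE indicE; case: ifPn => _; rewrite ?mule1 ?mule0.
  rewrite preimage_nnfun0//.
  rewrite measure0 mule0 integral0_eq// => x _.
  by rewrite indicE in_set0 mule0 mule0.
pose f_ := nnsfun_approx measurableT mf.
transitivity (lim (\int[normal_prob m s]_x (f_ n x)%:E @[n --> \oo])%E).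
  rewrite -monotone_convergence//=.
  - apply: eq_integral => ? /[!inE] xD; apply/esym/cvg_lim => //=.
    exact: cvg_nnsfun_approx.
  - by move=> n; exact/measurable_EFinP/measurable_funTS.

  - by move=> n ? _; rewrite lee_fin.
  - by move=> ? _ ? ? mn; rewrite lee_fin; exact/lefP/nd_nnsfun_approx.
under eq_fun do rewrite nnE.
rewrite -monotone_convergence//=.
- apply: eq_integral => x /[!inE] xD; apply/cvg_lim => //=.
  apply: cvgeZr => //; exact: cvg_nnsfun_approx.
- move=> n; apply: emeasurable_funM => //.
  exact/measurable_EFinP/measurable_funTS.
- by move=> n ? _; rewrite mule_ge0// lee_fin.
- move=> x _ ? ? mn; apply: lee_wpmul2r => //.
  by rewrite lee_fin; exact/lefP/nd_nnsfun_approx.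
Qed.

(* [G' = ((x + y b)^2 - (x^2 + y^2 s^2)) pdf], with [G] vanishing at infinity. *)
Lemma integral_quadratic_normal_pdf_itv (s x y M : R) : s != 0 -> 0 < M ->
  let G : R -> R := fun b : R =>
    - (2 * x * y * s ^+ 2 + y ^+ 2 * s ^+ 2 * b) * normal_pdf 0 s b in
  (\int[mu]_(b in `[(- M)%R, M]) ((x + y * b) ^+ 2 * normal_pdf 0 s b)%:E =
   (x ^+ 2 + y ^+ 2 * s ^+ 2)%:E *
     \int[mu]_(b in `[(- M)%R, M]) (normal_pdf 0 s b)%:E +
   (G M - G (- M))%:E)%E.
Proof.
move=> s0 M0 G.
have cpdf : continuous (normal_pdf 0 s) by exact: continuous_normal_pdf.
pose c := x ^+ 2 + y ^+ 2 * s ^+ 2.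
pose g := fun b => ((x + y * b) ^+ 2 - c) * normal_pdf 0 s b.
have cg : continuous g.
  move=> z; apply: cvgM; last exact: cpdf.
  apply: cvgB; last exact: cvg_cst.
  apply: (@continuous_comp _ _ _ (fun b => x + y * b) (fun u => u ^+ 2));
    last exact: exprn_continuous.
  by apply: cvgD; [exact: cvg_cst|apply: cvgM; [exact: cvg_cst|exact: cvg_id]].
have dG (z : R) : is_derive z (1 : R) G (g z).
  rewrite /G normal_pdfE// /g normal_pdfE// /normal_fun.
  apply: is_derive_eq; rewrite /GRing.scale/=.
  rewrite /c; field.
  by rewrite s0.
have intg : mu.-integrable `[(- M)%R, M] (EFin \o g).
  apply: continuous_compact_integrable; first exact: segment_compact.
  exact: continuous_subspaceT.
have intp : mu.-integrable `[(- M)%R, M] (EFin \o normal_pdf 0 s).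
  apply: continuous_compact_integrable; first exact: segment_compact.
  exact: continuous_subspaceT.
have ltM : - M < M by lra.
have cG : continuous G.
  by move=> z; apply: differentiable_continuous; apply/derivable1_diffP; have [] := dG z.
have <- : (\int[mu]_(x in `[(- M)%R, M]) (g x)%:E = (G M - G (- M))%:E)%E.
  rewrite (@continuous_FTC2 _ g G)//.
  - exact: continuous_subspaceT.
  - split; [by move=> z _; have [] := dG z| |].
    + by apply: cvg_at_right_filter; exact: cG.
    + by apply: cvg_at_left_filter; exact: cG.
  - by move=> z _; rewrite derive1E; have [_ ->] := dG z.
rewrite -integralZl//= -integralD//=; last exact: integrableZl.
by apply: eq_integral => z _; rewrite -EFinM -EFinD /g; congr EFin; rewrite -/c; ring.
Qed.

(** With [x] and [y] frozen at the values of an [F s]-measurable pair and [b] a Wiener increment,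
    this is the conditional second moment of one step. It is the limit of the identity on symmetric
    intervals. *)
Lemma normal_second_moment (s x y : R) : s != 0 ->
  (\int[normal_prob 0 s]_b ((x + y * b) ^+ 2)%:E = (x ^+ 2 + y ^+ 2 * s ^+ 2)%:E)%E.
Proof.
move=> s0.
pose c := x ^+ 2 + y ^+ 2 * s ^+ 2.
have mq : measurable_fun setT (fun b : measurableTypeR R => (x + y * b) ^+ 2).
  by apply: measurable_funX; apply: measurable_funD => //; apply: measurable_funM.
rewrite ge0_integral_normal_prob;
  [|exact/measurable_EFinP|by move=> b; rewrite lee_fin sqr_ge0].
pose D n : set R := `[(- n.+1%:R)%R, n.+1%:R]%classic.
have UD : \bigcup_n D n = setT.
  apply/seteqP; split => // z _.
  exists (Num.truncn `|z|) => //; rewrite /D/= in_itv/= -ler_norml.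
  by apply/ltW; rewrite truncnS_gt.
have ndD : nondecreasing_seq D.
  move=> m n mn; rewrite subsetEset; apply: subset_itv;
    rewrite bnd_simp ?lerN2 ler_nat ltnS//.
have mpdf : measurable_fun setT (normal_pdf 0 s : measurableTypeR R -> R).
  exact: measurable_normal_pdf.
have L (f : measurableTypeR R -> R) : measurable_fun setT f -> (forall z, 0 <= f z) ->
    (\int[mu]_(b in D n) (f b)%:E @[n --> \oo] --> \int[mu]_b (f b)%:E)%E.
  move=> mf f0; rewrite -UD; apply: ge0_nondecreasing_set_cvg_integral => //.
  - by move=> i; exact: measurable_itv.
  - by move=> i; apply/measurable_EFinP/measurable_funTS.
  - by move=> i z _; rewrite lee_fin.
under eq_integral do rewrite -EFinM.
apply: (cvg_unique _ (L (fun b => (x + y * b) ^+ 2 * normal_pdf 0 s b) _ _)) => //.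
- exact: measurable_funM.
- by move=> z; rewrite mulr_ge0// ?sqr_ge0 ?normal_pdf_ge0.
have E n := integral_quadratic_normal_pdf_itv x y s0 (ltr0Sn R n).
rewrite (funext E).
have H1 : (c%:E * \int[mu]_(b in D n) (normal_pdf 0 s b)%:E @[n --> \oo] --> c%:E * 1)%E.
  apply: cvgeZl => //.
  by rewrite -(integral_normal_pdf 0 s); apply: L => // z; exact: normal_pdf_ge0.
pose G : R -> R := fun b : R =>
    - (2 * x * y * s ^+ 2 + y ^+ 2 * s ^+ 2 * b) * normal_pdf 0 s b.
have H2 : ((G n.+1%:R - G (- n.+1%:R))%:E @[n --> \oo] --> 0)%E.
  apply: cvg_EFin; first exact: nearW.
  pose K := 4 * y ^+ 2 * s ^+ 4 * normal_peak s.
  (* The density is even, so the part of [G] with [x * y] cancels and, up to sign,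
     [2 y^2 s^2 M pdf(M)] remains. The bound [expR z >= 1 + z >= z] at [z = M^2 / (2 s^2)] gives the
     decay in [1 / M] and the constant [K]. *)
  have GK n : `|G n.+1%:R - G (- n.+1%:R)| <= K * n.+1%:R^-1.
    set M := n.+1%:R : R.
    have M0 : 0 < M by rewrite ltr0Sn.
    have -> : G M - G (- M) = - (2 * y ^+ 2 * s ^+ 2 * M * normal_pdf 0 s M).
      rewrite /G normal_pdfE// /normal_fun !subr0 sqrrN; ring.
    rewrite normrN ger0_norm; last first.
      by do ?[exact: sqr_ge0|exact: normal_pdf_ge0|exact: ltW|apply: mulr_ge0].
    have s2 : 0 < s ^+ 2 by rewrite exprn_even_gt0.
    rewrite normal_pdfE// /normal_fun subr0 mulNr expRN.
    have le1 : (expR (M ^+ 2 / (s ^+ 2 *+ 2)))^-1 <= s ^+ 2 *+ 2 / M ^+ 2.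
      rewrite -[leRHS]invf_div lef_pV2 ?posrE ?expR_gt0//; last first.
        by rewrite divr_gt0 ?exprn_gt0 ?pmulrn_lgt0.
      by apply: le_trans (expR_ge1Dx _); rewrite lerDr.
    have -> : K / M = 2 * y ^+ 2 * s ^+ 2 * M * (normal_peak s * (s ^+ 2 *+ 2 / M ^+ 2)).
      by rewrite /K; field; rewrite gt_eqF.
    apply: ler_wpM2l; first by do ?[exact: sqr_ge0|exact: ltW|apply: mulr_ge0].
    by apply: ler_wpM2l => //; exact: normal_peak_ge0.
  apply/norm_cvg0P.
  apply: (@squeeze_cvgr _ _ _ _ (cst 0) (fun n => K * n.+1%:R^-1)).
  - by apply: nearW => n; rewrite normr_ge0 GK.
  - exact: cvg_cst.
  - rewrite -(mulr0 K); apply: cvgM; [exact: cvg_cst|exact: cvg_harmonic].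
have := @cvgeD _ _ _ _ _ _ _ _ _ H1 H2.
by rewrite mule1 adde0; apply.
Qed.

End normal_second_moment.

Section second_moment.
Context {R : realType} {d : measure_display} {T : measurableType d}.
Context (P : probability T R) (F : filtration R T) (B : R -> T -> R).

(** A sigma-algebra coincides with the one it generates. Relative measurability thus becomes
    ordinary measurability on [g_sigma_algebraType (F t)], where the closure properties under sums,
    products and conditionals apply. *)
Lemma measurable_wrtP (t : R) (X : T -> R) : 0 <= t ->
  measurable_wrt (F t) X <->
  measurable_fun setT (X : g_sigma_algebraType (F t) -> R).
Proof.
move=> t0; have FE := measurable_g_measurableTypeE (filt_sigma_algebra F t0).
split=> [mX _ C mC|mX C mC].
  by rewrite setTI FE; exact: mX.
by rewrite -FE -[X in measurable X]setTI; exact: mX.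
Qed.

Lemma measurable_wrt_le (s t : R) (X : T -> R) : 0 <= s -> s <= t ->
  measurable_wrt (F s) X -> measurable_wrt (F t) X.
Proof. by move=> s0 st mX C mC; apply: (filt_mono s0 st); exact: mX. Qed.

Lemma measurable_wrt_measurable (t : R) (X : T -> R) : 0 <= t ->
  measurable_wrt (F t) X -> measurable_fun setT X.
Proof.
by move=> t0 mX _ C mC; rewrite setTI; apply: (filt_measurable t0); exact: mX.
Qed.

Lemma measurable_wrt_cst (t r : R) : 0 <= t -> measurable_wrt (F t) (cst r).
Proof. by move=> t0; apply/measurable_wrtP => //; exact: measurable_cst. Qed.

Definition second_moment (X : T -> R) : \bar R := (\int[P]_w (X w ^+ 2)%:E)%E.

Hypothesis hB : wiener P F B.

Lemma wiener_measurable t : 0 <= t -> measurable_wrt (F t) (B t).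
Proof. by case: hB => aB *; exact: aB. Qed.

(* The law of [(X, phi, B t - B s)] is a product, so Tonelli gives the identity
   without any integrability assumption. *)
Lemma second_moment_step (s t : R) (X phi : T -> R) : 0 <= s -> s < t ->
  measurable_wrt (F s) X -> measurable_wrt (F s) phi ->
  (second_moment (fun w => X w + phi w * (B t w - B s w))%R =
   second_moment X + (t - s)%:E * second_moment phi)%E.
Proof.
move=> s0 st mX mphi.
have t0 : 0 <= t by apply: le_trans (ltW st).
case: hB => aB _ indB gaussB _.
pose D w := B t w - B s w; pose Y w := (X w, phi w).
pose sg := Num.sqrt (t - s).
have sgE : sg ^+ 2 = t - s by rewrite sqr_sqrtr// subr_ge0 ltW.
have sg0 : sg != 0 by rewrite gt_eqF// sqrtr_gt0 subr_gt0.
have mD : measurable_fun setT D.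
  by apply: measurable_funB; apply: measurable_wrt_measurable (aB _ _).
have mX' := measurable_wrt_measurable s0 mX.
have mphi' := measurable_wrt_measurable s0 mphi.
have mY : measurable_fun setT Y by exact: measurable_fun_pair.
have FY A : measurable A -> F s (Y @^-1` A).
  move=> mA; rewrite -(measurable_g_measurableTypeE (filt_sigma_algebra F s0)).
  rewrite -[X in measurable X]setTI.
  have : measurable_fun setT (Y : g_sigma_algebraType (F s) -> _).
    by apply: measurable_fun_pair; exact/measurable_wrtP.
  by apply.
pose mu1 := distribution P (mfun_Sub (mem_set mY)).
pose mu2 := normal_prob (0 : R) sg.
pose Z w := (Y w, D w : measurableTypeR R).
have mZ : measurable_fun setT Z by exact: measurable_fun_pair.
pose mu := distribution P (mfun_Sub (mem_set mZ)).
(* Rectangles determine the measure. On them, the independence of [D] from [F s], which knows both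
   coordinates of [Y], and the Gaussian law of [D] give the product formula. *)
have muE A : measurable A -> (mu1 \x mu2)%E A = mu A.
  apply: product_measure_unique => A1 A2 mA1 mA2.
  have E2 : mu2 A2 = P (D @^-1` A2) by rewrite gaussB.
  transitivity (P (Y @^-1` A1) * P (D @^-1` A2))%E; last by rewrite -E2.
  rewrite /mu /mu1 /distribution /pushforward/= -indB//; exact: FY.
pose h (z : (R * R) * measurableTypeR R) : \bar R := ((z.1.1 + z.1.2 * z.2) ^+ 2)%:E.
have mh : measurable_fun setT h.
  apply/measurable_EFinP/measurable_funX/measurable_funD.
    by apply: measurableT_comp => //; exact: measurable_fst.
  apply: measurable_funM => //.
  by apply: measurableT_comp => //; exact: measurable_snd.
have h0 z : (0 <= h z)%E by rewrite lee_fin sqr_ge0.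
have -> : second_moment (fun w => X w + phi w * (B t w - B s w))%R = (\int[mu]_z h z)%E.
  by rewrite (ge0_integral_distribution _ mh h0).
rewrite -(eq_measure_integral mu (fun A mA _ => muE A mA)).
rewrite (fubini_tonelli1 _ mh h0) /fubini_F/= /h/=.
under eq_integral do rewrite normal_second_moment// sgE.
rewrite ge0_integral_distribution; last 2 first.
- apply/measurable_EFinP; apply: measurable_funD; last apply: measurable_funM => //.
    by apply: measurable_funX; exact: measurable_fst.
  by apply: measurable_funX; exact: measurable_snd.
- move=> y; rewrite lee_fin addr_ge0 ?sqr_ge0// mulr_ge0 ?sqr_ge0//.
  by rewrite subr_ge0 ltW.
transitivity (\int[P]_w ((X w ^+ 2)%:E + (t - s)%:E * (phi w ^+ 2)%:E))%E.
  by apply: eq_integral => w _; rewrite /= [X in (_ + X)%R]mulrC.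
rewrite ge0_integralD//=; last 4 first.
- by move=> w _; rewrite lee_fin sqr_ge0.
- by apply/measurable_EFinP; exact: measurable_funX.
- by move=> w _; rewrite -EFinM lee_fin mulr_ge0 ?sqr_ge0// subr_ge0 ltW.
- by apply: emeasurable_funM => //; apply/measurable_EFinP; exact: measurable_funX.
rewrite ge0_integralZl//.
- by apply/measurable_EFinP; exact: measurable_funX.
- by move=> w _; rewrite lee_fin sqr_ge0.
- by rewrite lee_fin subr_ge0 ltW.
Qed.

(** A discrete Ito isometry: each increment is independent of the past, so no cross term appears.
    Measurability is carried along because the sum up to [n] plays the part of [X] when
    [second_moment_step] adds one more step. *)
Lemma second_moment_sum (n : nat) (tau : nat -> R) (X : T -> R) (g : nat -> T -> R) :
  0 <= tau 0%N -> (forall j, (j < n)%N -> tau j < tau j.+1) ->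
  measurable_wrt (F (tau 0%N)) X ->
  (forall j, (j < n)%N -> measurable_wrt (F (tau j)) (g j)) ->
  measurable_wrt (F (tau n))
    (fun w => X w + \sum_(j < n) g j w * (B (tau j.+1) w - B (tau j) w)) /\
  (second_moment (fun w => X w + \sum_(j < n) g j w * (B (tau j.+1) w - B (tau j) w))%R =
   second_moment X + \sum_(j < n) (tau j.+1 - tau j)%:E * second_moment (g j))%E.
Proof.
move=> tau0; elim: n => [|n IH] ltt mX mg.
  split; first by under eq_fun do rewrite big_ord0 addr0.
  by rewrite big_ord0 adde0; congr second_moment; apply/funext => w;
    rewrite big_ord0 addr0.
have tau_ge0 : forall j, (j <= n.+1)%N -> 0 <= tau j.
  elim=> // j IHj jn; apply: le_trans (ltW (ltt j _)) => //; exact/IHj/ltnW.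
have [mY EY] := IH (fun j jn => ltt j (ltnW jn)) mX (fun j jn => mg j (ltnW jn)).
have tn := tau_ge0 n (leqnSn n).
have tnn : tau n < tau n.+1 by apply: ltt.
have E : (fun w => X w + \sum_(j < n.+1) g j w * (B (tau j.+1) w - B (tau j) w)) =
    (fun w => (X w + \sum_(j < n) g j w * (B (tau j.+1) w - B (tau j) w)) +
      g n w * (B (tau n.+1) w - B (tau n) w)).
  by apply/funext => w; rewrite big_ord_recr/= addrA.
rewrite E; split; last first.
  rewrite second_moment_step//; last exact: mg.
  by rewrite EY big_ord_recr/= addeA.
have tS := tau_ge0 n.+1 (leqnn _).
have up := measurable_wrt_le tn (ltW tnn).
apply/measurable_wrtP => //.
apply: measurable_funD; first by apply/measurable_wrtP => //; exact: up.
apply: measurable_funM; first by apply/measurable_wrtP => //; apply: up; exact: mg.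
apply: measurable_funB; apply/measurable_wrtP => //; first exact: wiener_measurable.
by apply: up; exact: wiener_measurable.
Qed.

End second_moment.

(** * Stochastic integrals of simple processes *)

Lemma increasing_steps_le {R : realType} (n : nat) (tau : nat -> R) :
  (forall j, (j < n)%N -> tau j < tau j.+1) ->
  forall i j, (i <= j <= n)%N -> tau i <= tau j.
Proof.
move=> ltt i; elim=> [|j IH]; first by rewrite leqn0 => /andP[/eqP->].
move=> /andP[]; rewrite leq_eqVlt => /predU1P[->//|]; rewrite ltnS => ij jn.
by apply: le_trans (ltW (ltt j jn)); apply: IH; rewrite ij ltnW.
Qed.

Lemma measurable_set_ler {d} {T : measurableType d} {R : realType} (f g : T -> R) :
  measurable_fun setT f -> measurable_fun setT g ->
  measurable [set w | f w <= g w].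
Proof.
move=> mf mg.
have := measurable_fun_ler mf mg measurableT (Y := [set true]) I.
by rewrite setTI.
Qed.

Section stochastic_sum.
Context {R : realType} {d : measure_display} {T : measurableType d}.
Context (P : probability T R) (F : filtration R T) (B : R -> T -> R).

Lemma second_moment_chebyshev (X : T -> R) (e : R) : measurable_fun setT X -> 0 < e ->
  ((e ^+ 2)%:E * P [set w | (e <= `|X w|)%R] <= second_moment P X)%E.
Proof.
move=> mX e0.
have e20 : 0 < e ^+ 2 by rewrite exprn_gt0.
have mX2 : measurable_fun setT (fun w => (X w ^+ 2)%:E).
  by apply/measurable_EFinP; exact: measurable_funX.
have := le_integral_abse P measurableT mX2 e20.
rewrite setTI.
under [X in (_ <= X)%E -> _]eq_integral do rewrite gee0_abs ?lee_fin ?sqr_ge0//.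
have E w : ((e ^+ 2)%:E <= `|(X w ^+ 2)%:E|)%E = (e <= `|X w|).
  rewrite abse_EFin lee_fin ger0_norm ?sqr_ge0// -(real_normK (num_real (X w))).
  by rewrite ler_pXn2r// nnegrE// ltW.
rewrite (_ : [set w | _] = [set w | e <= `|X w|])//.
by apply/seteqP; split => w /=; rewrite E.
Qed.

Hypothesis hB : wiener P F B.

(* Truncating the integrand at the first time its quadratic variation exceeds
   [b] keeps it adapted and makes it square integrable. *)
Lemma stochastic_sum_small (n : nat) (tau : nat -> R) (g : nat -> T -> R) (b e : R) :
  0 <= tau 0%N -> (forall j, (j < n)%N -> tau j < tau j.+1) ->
  (forall j, (j < n)%N -> measurable_wrt (F (tau j)) (g j)) ->
  0 <= b -> 0 < e ->
  exists N : set T, [/\ measurable N, (P N <= (b / e ^+ 2)%:E)%E &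
    forall w, ~ N w -> \sum_(j < n) g j w ^+ 2 * (tau j.+1 - tau j) <= b ->
      `|\sum_(j < n) g j w * (B (tau j.+1) w - B (tau j) w)| < e].
Proof.
move=> tau0 ltt mg b0 e0.
have tau_mono := increasing_steps_le ltt.
have tau_ge0 j : (j <= n)%N -> 0 <= tau j.
  by move=> jn; apply: le_trans (tau_mono 0%N j _).
pose q k w := \sum_(i < k) g i w ^+ 2 * (tau i.+1 - tau i).
have q_mono k w : (k <= n)%N -> q k w <= q n w.
  move=> kn; have : forall m, (k + m <= n)%N -> q k w <= q (k + m)%N w.
    elim=> [|m IH]; first by rewrite addn0.
    rewrite addnS => km; apply: le_trans (IH (ltnW km)) _.
    by rewrite [leRHS]/q big_ord_recr/= lerDl mulr_ge0 ?sqr_ge0// subr_ge0 ltW// ltt.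
  by move=> /(_ (n - k)%N); rewrite subnKC//; apply.
(* The test reads [q j.+1], which already counts step [j] but involves only [g 0], ..., [g j], all
   known at time [tau j]. The truncated integrand is thus adapted and never overshoots [b]. *)
pose g' j w := if q j.+1 w <= b then g j w else 0.
have mg' j : (j < n)%N -> measurable_wrt (F (tau j)) (g' j).
  move=> jn; have tj0 := tau_ge0 j (ltnW jn).
  have mgi i : (i <= j)%N ->
      measurable_fun setT (g i : g_sigma_algebraType (F (tau j)) -> R).
    move=> ij; apply/measurable_wrtP => //.
    apply: measurable_wrt_le (mg i _) => //.
      by apply/tau_ge0/ltnW/(leq_ltn_trans ij).
      by apply: tau_mono; rewrite ij ltnW.
    exact: leq_ltn_trans jn.
  apply/measurable_wrtP => //.
  have mq : measurable_fun setT (q j.+1 : g_sigma_algebraType (F (tau j)) -> R).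
    apply: measurable_sum => i; apply: measurable_funM => //.
    by apply: measurable_funX; apply: mgi; rewrite -ltnS.
  apply: measurable_fun_ifT => //; last exact: mgi.
  exact: measurable_fun_ler.
have q'b w : \sum_(j < n) (tau j.+1 - tau j) * g' j w ^+ 2 <= b.
  (* The bound by [q k w] is what makes the induction go through: if the test at step [k] passes,
     the sum is at most [q k.+1 w <= b]; if it fails, nothing is added. *)
  have : forall k, (k <= n)%N ->
      \sum_(j < k) (tau j.+1 - tau j) * g' j w ^+ 2 <= Num.min b (q k w).
    elim=> [|k IH] kn; first by rewrite big_ord0 /q big_ord0 le_min b0 lexx.
    have {}IH := IH (ltnW kn).
    have inc : 0 <= (tau k.+1 - tau k) * g k w ^+ 2.
      by rewrite mulr_ge0 ?sqr_ge0// subr_ge0 ltW// ltt.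
    rewrite big_ord_recr/= /g'; move: IH; rewrite !le_min => /andP[Hb Hq].
    have qS : q k.+1 w = q k w + (tau k.+1 - tau k) * g k w ^+ 2.
      by rewrite /q big_ord_recr/= [X in _ + X]mulrC.
    rewrite qS; case: ifPn => h; first by apply/andP; split; lra.
    by rewrite expr0n/= mulr0 addr0 Hb/=; lra.
  by move=> /(_ n (leqnn _)); rewrite le_min => /andP[].
have mg'T (j : 'I_n) :
    measurable_fun setT (fun w => ((tau j.+1 - tau j) * g' j w ^+ 2)%:E).
  apply/measurable_EFinP/measurable_funM => //; apply: measurable_funX.
  exact: measurable_wrt_measurable (tau_ge0 j (ltnW (ltn_ord j))) (mg' j (ltn_ord j)).
pose S' w := 0 + \sum_(j < n) g' j w * (B (tau j.+1) w - B (tau j) w).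
have [mS' ES'] :=
  second_moment_sum hB tau0 ltt (X := cst 0) (measurable_wrt_cst F 0 tau0) mg'.
have mS'T := measurable_wrt_measurable (tau_ge0 n (leqnn _)) mS'.
exists [set w | e <= `|S' w|]; split.
- by apply: measurable_set_ler => //; exact: measurableT_comp.
- rewrite mulrC EFinM lee_pdivlMl ?exprn_gt0//.
  apply: le_trans (second_moment_chebyshev mS'T e0) _.
  rewrite ES' {1}/second_moment; under eq_integral do rewrite expr0n/=.
  rewrite integral0 add0e.
  rewrite (eq_bigr (fun j : 'I_n =>
    \int[P]_w ((tau j.+1 - tau j) * g' j w ^+ 2)%:E)%E); last first.
    move=> j _; rewrite /second_moment -ge0_integralZl//=.
    - apply/measurable_EFinP/measurable_funX.
      exact: measurable_wrt_measurable (tau_ge0 j (ltnW (ltn_ord j))) (mg' j (ltn_ord j)).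
    - by move=> w _; rewrite lee_fin sqr_ge0.
    - by rewrite lee_fin subr_ge0 ltW// ltt.
  rewrite -ge0_integral_sum//=.
  + apply: (@le_trans _ _ (\int[P]_w b%:E)%E); last first.
      rewrite integral_cst// -[leRHS]mule1; apply: lee_wpmul2l; first by rewrite lee_fin.
      exact: probability_le1.
    apply: ge0_le_integral => //.
    * move=> w _; apply: sume_ge0 => j _.
      by rewrite lee_fin mulr_ge0 ?sqr_ge0// subr_ge0 ltW// ltt.
    * by apply: emeasurable_sum => j; exact: mg'T.
    * by move=> w _; rewrite sumEFin lee_fin q'b.
  + by move=> j w _; rewrite lee_fin mulr_ge0 ?sqr_ge0// subr_ge0 ltW// ltt.
- move=> w /negP; rewrite -ltNge /S' add0r => lt qb.
  suff -> : \sum_(j < n) g j w * (B (tau j.+1) w - B (tau j) w) =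
     \sum_(j < n) g' j w * (B (tau j.+1) w - B (tau j) w) by [].
  apply: eq_bigr => j _; rewrite /g'.
  suff -> : q j.+1 w <= b by [].
  apply: le_trans qb; rewrite -/(q n w).
  exact: q_mono.
Qed.

End stochastic_sum.

(* A common refinement: no point of [L] lies strictly inside a step. *)
Lemma grid_exists {R : realType} (s t : R) (L : seq R) : 0 <= s -> s <= t ->
  exists (n p : nat) (tau : nat -> R),
  [/\ tau 0%N = 0, tau n = t, (p <= n)%N /\ tau p = s,
      forall j, (j < n)%N -> tau j < tau j.+1 &
      forall j x, (j < n)%N -> x \in L -> x <= tau j \/ tau j.+1 <= x].
Proof.
move=> s0 st; have t0 := le_trans s0 st.
pose l0 := [:: 0, s, t & [seq x <- L | 0 <= x <= t]].
pose l := sort <=%R (undup l0).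
have meml x : (x \in l) = (x \in l0) by rewrite mem_sort mem_undup.
have l01 x : x \in l -> 0 <= x <= t.
  rewrite meml !inE => /or4P[/eqP->|/eqP->|/eqP->|]; rewrite ?lexx ?s0 ?t0 ?st//.
  by rewrite mem_filter => /andP[].
have lsz : (0 < size l)%N.
  have : 0 \in l by rewrite meml inE eqxx.
  by case: l {meml l01}.
have sl : sorted <%R l.
  by rewrite lt_sorted_uniq_le sort_uniq undup_uniq sort_le_sorted.
pose tau j := nth t l j.
have tau_lt i j : (i < j < size l)%N -> tau i < tau j.
  move=> /andP[ij jl]; rewrite /tau lt_sorted_ltn_nth// inE//.
  exact: ltn_trans jl.
have tau_le i j : (i <= j < size l)%N -> tau i <= tau j.
  move=> /andP[]; rewrite leq_eqVlt => /predU1P[->//|ij jl].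
  by apply/ltW/tau_lt; rewrite ij.
have taul j : (j < size l)%N -> 0 <= tau j <= t by move=> jl; apply/l01/mem_nth.
have idx x : x \in l -> exists2 i, (i <= (size l).-1)%N & tau i = x.
  move=> xl; exists (index x l); last exact: nth_index.
  by rewrite -ltnS prednK// index_mem.
exists (size l).-1.
have [p pl taup] : exists2 i, (i <= (size l).-1)%N & tau i = s.
  by apply: idx; rewrite meml !inE eqxx orbT.
exists p, tau; split => //.
- have [i il i0] : exists2 i, (i <= (size l).-1)%N & tau i = 0.
    by apply: idx; rewrite meml !inE eqxx.
  apply/eqP; rewrite eq_le; apply/andP; split; last by have /andP[] := taul 0%N lsz.
  by rewrite -[leRHS]i0; apply: tau_le; rewrite /= -(prednK lsz) ltnS.
- have [i il it] : exists2 i, (i <= (size l).-1)%N & tau i = t.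
    by apply: idx; rewrite meml !inE eqxx !orbT.
  apply/eqP; rewrite eq_le; apply/andP; split.
    by have /andP[] : 0 <= tau (size l).-1 <= t by apply: taul; rewrite prednK.
  by rewrite -[leLHS]it; apply: tau_le; rewrite il prednK/=.
- by move=> j jn; apply: tau_lt; rewrite leqnn/= -(prednK lsz) ltnS.
- move=> j x jn xL.
  have jl : (j.+1 < size l)%N by rewrite -(prednK lsz) ltnS.
  have /andP[tj0 _] := taul j (ltnW jl).
  have /andP[_ tjt] := taul j.+1 jl.
  have [x0|x0] := ltP x 0; first by left; apply: ltW; apply: lt_le_trans tj0.
  have [xt|xt] := leP x t; last by right; apply: ltW; apply: le_lt_trans xt.
  have [i il <-] : exists2 i, (i <= (size l).-1)%N & tau i = x.
    by apply: idx; rewrite meml !inE mem_filter xL x0 xt !orbT.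
  have [ij|ij] := leqP i j; first by left; apply: tau_le; rewrite ij ltnW.
  by right; apply: tau_le; rewrite ij/= -(prednK lsz) ltnS.
Qed.

Lemma indic_itvoc {R : realType} (a b x : R) :
  \1_(`]a, b]) x = (a < x <= b)%R%:R :> R.
Proof. by rewrite indicE mem_setE/= in_itv. Qed.

Section simple_process_on_grid.
Context {R : realType} {d : measure_display} {T : measurableType d}.
Context (F : filtration R T) (B : R -> T -> R) (S : simple_process F).
Variables (n : nat) (tau : nat -> R).
Hypothesis tau0 : tau 0%N = 0.
Hypothesis ltt : forall j, (j < n)%N -> tau j < tau j.+1.
Hypothesis gap : forall j i, (j < n)%N -> (i <= sp_size S)%N ->
  sp_time S i <= tau j \/ tau j.+1 <= sp_time S i.

(** Coefficients act on intervals open on the left and closed on the right, so the value on a step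
    is the one at its right end point; at [tau j] the value may still be that of the preceding
    step. *)
Lemma sp_evalE w j r : (j < n)%N -> tau j < r <= tau j.+1 ->
  sp_eval S r w = sp_eval S (tau j.+1) w.
Proof.
move=> jn /andP[jr rj]; apply: eq_bigr => i _; congr (_ * _).
rewrite !indic_itvoc; congr (_ %:R); congr nat_of_bool.
have [h1|h1] := gap jn (ltnW (ltn_ord i)); have [h2|h2] := gap jn (ltn_ord i).
- rewrite (le_lt_trans h1 jr) (le_lt_trans h1 (ltt jn))/=.
  by rewrite leNgt (le_lt_trans h2 jr) leNgt (le_lt_trans h2 (ltt jn)).
- by rewrite (le_lt_trans h1 jr) (le_lt_trans h1 (ltt jn)) h2 (le_trans rj h2).
- by rewrite !ltNge h1 (le_trans rj h1).
- by rewrite !ltNge h1 (le_trans rj h1).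
Qed.

(** Predictability: a coefficient active at [tau j.+1] starts strictly before [tau j.+1], hence by
    [gap] no later than [tau j], where it is already known. *)
Lemma sp_eval_measurable_wrt j : (j < n)%N -> 0 <= tau j ->
  measurable_wrt (F (tau j)) (sp_eval S (tau j.+1)).
Proof.
move=> jn tj0; apply/measurable_wrtP => //; apply: measurable_sum => i.
rewrite indic_itvoc; case: (boolP (_ && _)) => [/andP[h1 _]|_]; last first.
  by under eq_fun do rewrite mulr0; exact: measurable_cst.
under eq_fun do rewrite mulr1.
apply/measurable_wrtP => //.
apply: measurable_wrt_le (sp_coef_adapted (ltn_ord i)); first exact: sp_time_ge0.
have [//|] := gap jn (ltnW (ltn_ord i)).
by rewrite leNgt h1.
Qed.

(** Once the two sums are exchanged, a fixed coefficient multiplies an increment of [B] cut at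
    [tau p]. It telescopes over the grid steps inside the interval of that coefficient, because no
    step straddles an end point. *)
Lemma sp_integralE w p : (p <= n)%N ->
  sp_integral B S (tau p) w =
  \sum_(j < p) sp_eval S (tau j.+1) w * (B (tau j.+1) w - B (tau j) w).
Proof.
move=> pn.
under [RHS]eq_bigr do rewrite /sp_eval mulr_suml.
rewrite exchange_big/=; apply: eq_bigr => i _.
under eq_bigr do rewrite -mulrA.
rewrite -mulr_sumr; congr (_ * _).
elim: p pn => [|p IH] pn.
  by rewrite big_ord0 tau0 !min_r ?sp_time_ge0// subrr.
rewrite big_ord_recr/= -IH; last exact: ltnW.
rewrite indic_itvoc.
have lt := ltt pn.
have le_t := sp_time_homo S (leqnSn i).
have [h1|h1] := gap pn (ltnW (ltn_ord i)); have [h2|h2] := gap pn (ltn_ord i).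
- have lt1 := le_lt_trans h1 lt; have lt2 := le_lt_trans h2 lt.
  by rewrite !min_l ?(ltW lt1) ?(ltW lt2)// leNgt lt2 andbF mul0r addr0.
- have lt1 := le_lt_trans h1 lt; have lt2 := lt_le_trans lt h2.
  rewrite lt1 h2/= mul1r (min_l h1) (min_l (ltW lt1)) (min_r h2) (min_r (ltW lt2)).
  by ring.
- by have := le_lt_trans (le_trans le_t h2) (lt_le_trans lt h1); rewrite ltxx.
- have lt1 := lt_le_trans lt h1; have lt2 := lt_le_trans lt h2.
  rewrite ltNge h1/= mul0r (min_r h1) (min_r (ltW lt1)) (min_r h2) (min_r (ltW lt2)).
  by ring.
Qed.

End simple_process_on_grid.

(** * Errors in probability and their measurability *)

Section convergence.
Context {R : realType} {d : measure_display} {T : measurableType d}.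
Context (P : probability T R) (F : filtration R T) (B : R -> T -> R).
Local Notation mu := (@lebesgue_measure R).

Lemma cvg_in_probability_lt (X_ : nat -> T -> \bar R) (X : T -> \bar R) (e eps : R) :
  cvg_in_probability P X_ X -> 0 < e -> 0 < eps ->
  \forall n \near \oo, (P [set w | (e%:E <= `|X_ n w - X w|)%E] < eps%:E)%E.
Proof.
move=> cX e0 eps0; have := cX _ e0.
move=> /(_ [set x | (x < eps%:E)%E]); apply.
apply: open_nbhs_nbhs; split; last by rewrite /= lte_fin.
exact: open_ereal_lt_ereal.
Qed.

Lemma measurable_sp_eval (S : simple_process F) :
  measurable_fun setT (fun z : measurableTypeR R * T => sp_eval S z.1 z.2).
Proof.
apply: measurable_sum => i; apply: measurable_funM.
  apply: (measurableT_comp (f := sp_coef S i)) => //.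
  apply: measurable_wrt_measurable (sp_coef_adapted (ltn_ord i)).
  exact: sp_time_ge0.
have mI :
    measurable_fun setT (\1_(`]sp_time S i, sp_time S i.+1]) : measurableTypeR R -> R).
  by apply: measurable_indic; exact: measurable_itv.
by apply: (measurableT_comp mI); exact: measurable_fst.
Qed.

Section square_error.
Variables (H : R -> T -> R) (S : simple_process F) (t : R).
Hypothesis iH : ito_integrand P F H.

(** Viewed on the product of time and [T] so that Tonelli makes its time integral measurable in [w]:
    two exceptional events of [ito_increment] are level sets of such integrals. *)
Definition square_error (z : measurableTypeR R * T) : \bar R :=
  (((sp_eval S z.1 z.2 - H z.1 z.2) ^+ 2)%:E)%E.

Let mD (i : interval R) :
  measurable [set z : measurableTypeR R * T | (z.1 : R) \in i].
Proof.
have mfst : measurable_fun setT (fst : measurableTypeR R * T -> measurableTypeR R).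
  exact: measurable_fst.
by have := mfst measurableT [set` i] (measurable_itv _); rewrite setTI.
Qed.

(** Extended by zero because the values of [H] at negative times are arbitrary: joint measurability
    of [H] is available on nonnegative times only. *)
Let square_error0t := square_error \_ [set z | (z.1 : R) \in `[0, t]].

Lemma measurable_square_error : measurable_fun setT square_error0t.
Proof.
apply/(measurable_restrictT _ (mD _)).
apply/measurable_EFinP/measurable_funX/measurable_funB.
  exact: measurable_funTS (measurable_sp_eval S).
case: iH => mH _ _; apply: measurable_funS mH.
  rewrite [X in measurable X](_ : _ = [set z : R * T | (z.1 : R) \in `[0, +oo[]).
    exact: mD.
  by apply/seteqP; split => z /=; rewrite in_itv/= andbT.
by move=> z /=; rewrite in_itv/= => /andP[].
Qed.

Let square_errorE w : (fun r => square_error0t (r, w)) =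
  ((fun r => square_error (r, w)) \_ `[0, t]).
Proof.
apply/funext => r; rewrite /square_error0t !patchE.
have -> // : ((r, w) \in [set z : R * T | (z.1 : R) \in `[0, t]]) =
    (r \in `[0, t]%classic).
by apply/idP/idP; rewrite !inE.
Qed.

Lemma measurable_fun_square_error w :
  measurable_fun `[0, t]%classic (fun r : measurableTypeR R => square_error (r, w)).
Proof.
apply/(measurable_restrictT _ (measurable_itv `[0, t])); rewrite -square_errorE.
exact: (measurable_fun_pair1 w measurable_square_error).
Qed.

Lemma measurable_int_square_error :
  measurable_fun setT (fun w => \int[mu]_(r in `[0%R, t]) square_error (r, w))%E.
Proof.
under eq_fun do rewrite integral_mkcond -square_errorE.
apply: (measurable_fun_fubini_tonelli_G (m1 := mu) _ measurable_square_error).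
by move=> z; rewrite /square_error0t patchE; case: ifP => // _; rewrite lee_fin sqr_ge0.
Qed.

End square_error.
End convergence.

(** * Truncation and elementary estimates *)

Definition clip {R : realType} (e x : R) : R := Num.max (- e) (Num.min e x).

Lemma clip_bound {R : realType} (e x : R) : 0 <= e -> `|clip e x| <= e.
Proof.
move=> e0; rewrite /clip ler_norml.
by rewrite le_max lexx/= ge_max ge_min lexx/= andbT; lra.
Qed.

Lemma clip_id {R : realType} (e x : R) : `|x| <= e -> clip e x = x.
Proof. by rewrite ler_norml => /andP[h1 h2]; rewrite /clip min_r// max_r. Qed.

(** [clip e] is the metric projection onto [[-e, e]], so no point [y] of that interval is closer to
    [x]. *)
Lemma clip_dist {R : realType} (e x y : R) : `|y| <= e -> `|x - clip e x| <= `|x - y|.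
Proof.
rewrite ler_norml => /andP[h1 h2].
have [x1|x1] := leP x (- e).
  rewrite /clip min_r ?max_l//; last by lra.
  by rewrite !ler0_norm; lra.
have [x2|x2] := leP e x.
  rewrite /clip min_l ?max_r//; last by lra.
  by rewrite !ger0_norm; lra.
have -> : clip e x = x by apply: clip_id; rewrite ler_norml !ltW.
by rewrite subrr normr0.
Qed.

Lemma measurable_fun_clip {d} {T : measurableType d} {R : realType} (e : R) (f : T -> R) :
  measurable_fun setT f -> measurable_fun setT (fun w => clip e (f w)).
Proof.
move=> mf; apply: (measurable_maxr (f := cst (- e))) => //.
exact: (measurable_minr (f := cst e)).
Qed.

Lemma sum_step_le_integral {R : realType} (n : nat) (tau c : nat -> R) (u : R -> \bar R) :
  (forall r, 0 <= u r)%E ->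
  (forall j, (j < n)%N -> tau j < tau j.+1) ->
  measurable_fun `]tau 0%N, tau n]%classic (u : measurableTypeR R -> \bar R) ->
  (forall j, (j < n)%N -> 0 <= c j) ->
  (forall j r, (j < n)%N -> (tau j < r <= tau j.+1)%R -> ((c j)%:E <= u r)%E) ->
  ((\sum_(j < n) c j * (tau j.+1 - tau j))%:E <=
    \int[lebesgue_measure]_(r in `](tau 0%N), (tau n)]) u r)%E.
Proof.
move=> u0; elim: n => [|n IH] ltt mu c0 cu.
  by rewrite big_ord0 set_itvoc0 integral_set0.
have t0n : forall k, (k <= n.+1)%N -> tau 0%N <= tau k.
  by elim=> // k IHk kn; apply: le_trans (ltW (ltt k kn)); apply/IHk/ltnW.
have U : `]tau 0%N, tau n.+1]%classic =
    `]tau 0%N, tau n]%classic `|` `]tau n, tau n.+1]%classic :> set R.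
  by rewrite -itv_bndbnd_setU// bnd_simp ?t0n// ltW// ltt.
rewrite U ge0_integral_setU//=; last 2 first.
- by rewrite -U.
- apply/disj_setPS => r /=; rewrite !in_itv/= => -[/andP[_ h1] /andP[h2 _]].
  by move: (lt_le_trans h2 h1); rewrite ltxx.
rewrite big_ord_recr/= EFinD; apply: leeD.
  apply: IH => [j jn||j jn|j r jn]; first by apply: ltt; exact: ltnW.
    by apply: measurable_funS mu => //; rewrite U; exact: subsetUl.
    by apply: c0; exact: ltnW.
  by apply: cu; exact: ltnW.
apply: (@le_trans _ _ (\int[lebesgue_measure]_(r in `](tau n), (tau n.+1)]) (c n)%:E)%E).
  by rewrite integral_cst//= lebesgue_measure_itv/= lte_fin ltt.
apply: ge0_le_integral => //=.
- by move=> r _; rewrite lee_fin c0.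
- by apply: measurable_funS mu => //; rewrite U; exact: subsetUr.
- by move=> r; rewrite in_itv/=; exact: cu.
Qed.

(** Young's inequality. Taking [e] proportional to [c] makes the last term of order [c]: it is
    applied with [e = c = eta] inside a step, and with [e = eta * h], [c = 2 * eta * h] to the
    remainders. *)
Lemma second_moment_addD {d} {T : measurableType d} {R : realType}
    (P : probability T R) (X Y : T -> R) (e c : R) : 0 < e ->
  measurable_fun setT X -> measurable_fun setT Y -> (forall w, `|Y w| <= c) ->
  (second_moment P (fun w => X w + Y w)%R <=
    (1 + e)%:E * second_moment P X + ((1 + e^-1) * c ^+ 2)%:E)%E.
Proof.
move=> e0 mX mY Yc.
have mX2 : measurable_fun setT (fun w => (X w ^+ 2)%:E).
  by apply/measurable_EFinP; exact: measurable_funX.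
have e'0 : 0 < e^-1 by rewrite invr_gt0.
apply: (@le_trans _ _
  (\int[P]_w ((1 + e)%:E * (X w ^+ 2)%:E + ((1 + e^-1) * c ^+ 2)%:E))%E).
  apply: ge0_le_integral => //.
  - by move=> w _; rewrite lee_fin sqr_ge0.
  - by apply/measurable_EFinP/measurable_funX; exact: measurable_funD.
  - apply: emeasurable_funD => //.
    by apply: emeasurable_funM.
  - move=> w _; rewrite -EFinM -EFinD lee_fin.
    have Y2 : Y w ^+ 2 <= c ^+ 2.
      rewrite -(real_normK (num_real (Y w))) ler_pXn2r ?nnegrE//.
      by apply: le_trans (Yc w).
    apply: (@le_trans _ _ ((1 + e) * X w ^+ 2 + (1 + e^-1) * Y w ^+ 2)); last first.
      by rewrite lerD2l ler_wpM2l//; lra.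
    rewrite -subr_ge0.
    have -> : (1 + e) * X w ^+ 2 + (1 + e^-1) * Y w ^+ 2 - (X w + Y w) ^+ 2 =
      e * (X w - e^-1 * Y w) ^+ 2 by field; rewrite gt_eqF.
    by rewrite mulr_ge0 ?sqr_ge0// ltW.
have k0 : 0 <= (1 + e^-1) * c ^+ 2 by rewrite mulr_ge0 ?sqr_ge0//; lra.
rewrite ge0_integralD//=; last 2 first.
- by move=> w _; rewrite -EFinM lee_fin mulr_ge0 ?sqr_ge0//; lra.
- by apply: emeasurable_funM.
rewrite ge0_integralZl//=; last 2 first.
- by move=> w _; rewrite lee_fin sqr_ge0.
- by rewrite lee_fin; lra.
apply: leeD => //.
rewrite integral_cst// -[leRHS]mule1; apply: lee_wpmul2l; first by rewrite lee_fin.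
exact: probability_le1.
Qed.

(** * Increments of Ito integrals *)

Lemma probability_setU_le {d} {T : measurableType d} {R : realType}
    (P : probability T R) (A1 A2 : set T) (a1 a2 : R) :
  measurable A1 -> measurable A2 -> (P A1 <= a1%:E)%E -> (P A2 <= a2%:E)%E ->
  (P (A1 `|` A2) <= (a1 + a2)%:E)%E.
Proof.
move=> mA1 mA2 h1 h2; apply: (@le_trans _ _ (P A1 + P A2)%E).
  exact: measureU2.
by rewrite EFinD; exact: leeD.
Qed.

Section increment.
Context {R : realType} {d : measure_display} {T : measurableType d}.
Context (P : probability T R) (F : filtration R T) (B : R -> T -> R).
Hypothesis hB : wiener P F B.
Local Notation mu := (@lebesgue_measure R).

Lemma measurable_sp_integral (S : simple_process F) (t : R) : 0 <= t ->
  measurable_fun setT (sp_integral B S t).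
Proof.
move=> t0; apply: measurable_sum => i.
have ti j : 0 <= Num.min (sp_time S j) t by rewrite le_min sp_time_ge0.
apply: measurable_funM.
  exact: measurable_wrt_measurable (sp_time_ge0 _ _) (sp_coef_adapted (ltn_ord i)).
by apply: measurable_funB; apply: measurable_wrt_measurable (wiener_measurable hB _).
Qed.

(** Let [x] and [x'] be the values of [S] and [S']. Before [tau p] both approximate the same [H],
    and [(x - x')^2 <= 2 (x - H)^2 + 2 (x' - H)^2]. After [tau p], the part removed by [clip] is the
    distance from [x - H (tau p)] to [[-eta, eta]]; this interval contains [H r - H (tau p)], so the
    distance is at most [|x - H r|]. *)
Lemma sum_sqr_le_square_error (H : R -> T -> R) (S S' : simple_process F)
    (n p : nat) (tau : nat -> R) (eta : R) (w : T) :
  ito_integrand P F H -> 0 <= eta ->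
  tau 0%N = 0 -> (p <= n)%N ->
  (forall j, (j < n)%N -> tau j < tau j.+1) ->
  (forall j i, (j < n)%N -> (i <= sp_size S)%N ->
    sp_time S i <= tau j \/ tau j.+1 <= sp_time S i) ->
  (forall j i, (j < n)%N -> (i <= sp_size S')%N ->
    sp_time S' i <= tau j \/ tau j.+1 <= sp_time S' i) ->
  (forall r, tau p <= r <= tau n -> `|H r w - H (tau p) w| <= eta) ->
  ((\sum_(j < n) (if (j < p)%N then
      sp_eval S (tau j.+1) w - sp_eval S' (tau j.+1) w else
      (sp_eval S (tau j.+1) w - H (tau p) w) -
        clip eta (sp_eval S (tau j.+1) w - H (tau p) w)) ^+ 2 *
      (tau j.+1 - tau j))%:E <=
   2%:E * \int[mu]_(r in `[0%R, (tau n)]) square_error H S (r, w) +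
   2%:E * \int[mu]_(r in `[0%R, (tau p)]) square_error H S' (r, w))%E.
Proof.
move=> iH eta0 tau0 pn ltt gap gap' osc.
pose g := H (tau p) w.
have tau_le := increasing_steps_le ltt.
have mS := measurable_fun_square_error S (t := tau n) iH w.
have mS' := measurable_fun_square_error S' (t := tau p) iH w.
have sq0 U r : (0 <= square_error H U (r, w))%E by rewrite lee_fin sqr_ge0.
pose err' : measurableTypeR R -> \bar R :=
  (fun r => square_error H S' (r, w)) \_ `[0, tau p].
pose u r : \bar R := (2%:E * square_error H S (r, w) + 2%:E * err' r)%E.
have e0 r : (0 <= err' r)%E by rewrite /err' patchE; case: ifP.
have u0 r : (0 <= u r)%E by rewrite adde_ge0// mule_ge0// lee_fin.
have mS'p : measurable_fun setT err'.
  by apply/(measurable_restrictT _ (measurable_itv _)).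
have mu_ : measurable_fun `[0, tau n]%classic (u : measurableTypeR R -> \bar R).
  apply: emeasurable_funD; apply: emeasurable_funM => //.
  exact: measurable_funTS.
have sub : `]tau 0%N, tau n]%classic `<=` `[0, tau n]%classic.
  by move=> r /=; rewrite tau0 !in_itv/= => /andP[/ltW-> ->].
pose c j := (if (j < p)%N then sp_eval S (tau j.+1) w - sp_eval S' (tau j.+1) w else
  (sp_eval S (tau j.+1) w - g) - clip eta (sp_eval S (tau j.+1) w - g)) ^+ 2.
apply: (@le_trans _ _ (\int[mu]_(r in `](tau 0%N), (tau n)]) u r)%E).
  apply: (@sum_step_le_integral _ _ _ c) => //.
  - by apply: measurable_funS mu_ => //; exact: measurable_itv.
  - by move=> j _; exact: sqr_ge0.
  move=> j r jn rj; have /andP[jr rj'] := rj.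
  rewrite /c -(sp_evalE ltt gap w jn rj) -(sp_evalE ltt gap' w jn rj).
  set x := sp_eval S r w; set x' := sp_eval S' r w.
  have [jp|pj] := ltnP j p.
    have r0p : r \in `[0, tau p]%classic.
      rewrite inE/= in_itv/=; apply/andP; split.
        apply: ltW; apply: le_lt_trans jr; rewrite -tau0; apply: tau_le.
        by rewrite leq0n ltnW.
      by apply: le_trans rj' _; apply: tau_le; rewrite jp.
    rewrite /u /err' patchE r0p /square_error/= -!EFinM -EFinD lee_fin.
    rewrite -/x -/x' -subr_ge0.
    have -> : 2 * (x - H r w) ^+ 2 + 2 * (x' - H r w) ^+ 2 - (x - x') ^+ 2 =
      ((x - H r w) + (x' - H r w)) ^+ 2 by ring.
    exact: sqr_ge0.
  apply: (@le_trans _ _ (square_error H S (r, w))); last first.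
    rewrite /u; apply: (@le_trans _ _ (2%:E * square_error H S (r, w))%E).
      by rewrite /square_error -EFinM lee_fin ler_peMl ?sqr_ge0//; lra.
    by rewrite leeDl// mule_ge0// lee_fin.
  rewrite /square_error lee_fin/= -/x.
  rewrite -(real_normK (num_real (_ - clip _ _))) -(real_normK (num_real (x - H r w))).
  rewrite ler_pXn2r ?nnegrE//.
  have -> : x - H r w = (x - g) - (H r w - g) by ring.
  apply: clip_dist; apply: osc; apply/andP; split.
    by apply: ltW; apply: le_lt_trans jr; apply: tau_le; rewrite pj ltnW.
  by apply: le_trans rj' _; apply: tau_le; rewrite jn leqnn.
apply: (@le_trans _ _ (\int[mu]_(r in `[0%R, (tau n)]) u r)%E).
  by apply: ge0_subset_integral => //.
rewrite ge0_integralD//=; last 4 first.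
- by move=> r _; rewrite mule_ge0// lee_fin.
- by apply: emeasurable_funM.
- by move=> r _; rewrite mule_ge0// lee_fin.
- by apply: emeasurable_funM => //; exact: measurable_funTS.
rewrite ge0_integralZl//=.
apply: leeD => //.
rewrite ge0_integralZl//=; last exact: measurable_funTS.
apply: lee_wpmul2l; first by rewrite lee_fin.
rewrite [leRHS]integral_mkcond/=.
by apply: ge0_subset_integral.
Qed.

(* [rho] is the integral over [(s, t]] of [clip eta (S - H s)] for a simple
   process [S] close to [H]; its values are controlled only through the bound
   on second moments, which is all that an Euler step needs. *)
Lemma ito_increment (H : R -> T -> R) (s t : R) (Js Jt : T -> R) (eta kappa eps : R) :
  0 <= s -> s < t -> 0 < eta -> 0 < kappa -> 0 < eps ->
  is_ito_integral P F B H s Js -> is_ito_integral P F B H t Jt ->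
  exists (rho : T -> R) (N : set T),
  [/\ measurable_wrt (F t) rho,
      forall X phi : T -> R, measurable_wrt (F s) X -> measurable_wrt (F s) phi ->
        (second_moment P (fun w => X w + phi w * (B t w - B s w) + rho w)%R <=
         second_moment P X + (t - s)%:E *
           ((1 + eta)%:E * second_moment P phi + ((1 + eta^-1) * eta ^+ 2)%:E))%E,
      measurable N, (P N <= eps%:E)%E &
      forall w, ~ N w -> (forall r, s <= r <= t -> `|H r w - H s w| <= eta) ->
        `|Jt w - Js w - H s w * (B t w - B s w) - rho w| <= kappa].
Proof.
move=> s0 st eta0 kappa0 eps0 [iH mJs [S'_ [cS' cJs]]] [_ mJt [S_ [cS cJt]]].
have t0 : 0 <= t := le_trans s0 (ltW st).
(* Five exceptional events share [eps]: four from convergence in probability, one from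
   [stochastic_sum_small]. Three errors share [kappa]: those of the two simple integrals and the
   residual sum. [b] is chosen so that [b / k3 ^+ 2 = e5], and [b / 4] so that the doubled square
   errors add up to at most [b]. *)
pose e5 := eps / 5; pose k3 := kappa / 3; pose b := e5 * k3 ^+ 2.
have e50 : 0 < e5 by rewrite divr_gt0.
have k30 : 0 < k3 by rewrite divr_gt0.
have b0 : 0 < b by rewrite mulr_gt0 ?exprn_gt0.
have b4 : 0 < b / 4 by rewrite divr_gt0.
near \oo => n0.
have A1 : (P [set w | ((b / 4)%:E <=
    `|\int[mu]_(r in `[0%R, t]) square_error H (S_ n0) (r, w) - cst 0 w|)%E] <=
    e5%:E)%E.
  by apply: ltW; near: n0; exact: cvg_in_probability_lt.
have A2 : (P [set w | ((b / 4)%:E <=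
    `|\int[mu]_(r in `[0%R, s]) square_error H (S'_ n0) (r, w) - cst 0 w|)%E] <=
    e5%:E)%E.
  by apply: ltW; near: n0; exact: cvg_in_probability_lt.
have A3 : (P [set w |
    (k3%:E <= `|(sp_integral B (S_ n0) t w)%:E - (Jt w)%:E|)%E] <= e5%:E)%E.
  by apply: ltW; near: n0; exact: (cvg_in_probability_lt cJt).
have A4 : (P [set w |
    (k3%:E <= `|(sp_integral B (S'_ n0) s w)%:E - (Js w)%:E|)%E] <= e5%:E)%E.
  by apply: ltW; near: n0; exact: (cvg_in_probability_lt cJs).
move: A1 A2 A3 A4; move: (S_ n0) (S'_ n0) => S S'.
set N1 := [set w | _]; set N2 := [set w | _].
set N3 := [set w | _]; set N4 := [set w | _].
move=> A1 A2 A3 A4.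
have mN1 : measurable N1.
  rewrite -[X in measurable X]setTI; apply: emeasurable_fun_c_infty => //.
  apply: measurableT_comp => //; apply: emeasurable_funB => //.
  exact: measurable_int_square_error iH.
have mN2 : measurable N2.
  rewrite -[X in measurable X]setTI; apply: emeasurable_fun_c_infty => //.
  apply: measurableT_comp => //; apply: emeasurable_funB => //.
  exact: measurable_int_square_error iH.
have mN3 : measurable N3.
  rewrite -[X in measurable X]setTI; apply: emeasurable_fun_c_infty => //.
  apply: measurableT_comp => //; apply: emeasurable_funB; apply/measurable_EFinP => //.
  exact: (measurable_sp_integral S t0).
have mN4 : measurable N4.
  rewrite -[X in measurable X]setTI; apply: emeasurable_fun_c_infty => //.
  apply: measurableT_comp => //; apply: emeasurable_funB; apply/measurable_EFinP => //.
  exact: (measurable_sp_integral S' s0).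
have [n [p [tau [tau0 taun [pn taup] ltt gap]]]] :=
  grid_exists ([seq sp_time S i | i <- iota 0 (sp_size S).+1] ++
               [seq sp_time S' i | i <- iota 0 (sp_size S').+1]) s0 (ltW st).
have gapS j i : (j < n)%N -> (i <= sp_size S)%N ->
    sp_time S i <= tau j \/ tau j.+1 <= sp_time S i.
  move=> jn iS; apply: gap => //; rewrite mem_cat map_f// mem_iota/=.
  by rewrite add0n ltnS.
have gapS' j i : (j < n)%N -> (i <= sp_size S')%N ->
    sp_time S' i <= tau j \/ tau j.+1 <= sp_time S' i.
  move=> jn iS; apply: gap => //; rewrite mem_cat orbC map_f// mem_iota/=.
  by rewrite add0n ltnS.
have tau_le := increasing_steps_le ltt.
have tau_ge0 j : (j <= n)%N -> 0 <= tau j by move=> jn; rewrite -tau0 tau_le.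
pose y j w := sp_eval S (tau j.+1) w.
pose y' j w := sp_eval S' (tau j.+1) w.
pose g := H s.
have mg j : (p <= j <= n)%N -> measurable_wrt (F (tau j)) g.
  move=> pj; apply: (measurable_wrt_le s0); first by rewrite -taup tau_le.
  by case: iH => _ aH _; exact: aH.
pose dB j w := B (tau j.+1) w - B (tau j) w.
pose m := (n - p)%N; have nE : n = (p + m)%N by rewrite subnKC.
pose rho w := \sum_(j < m) clip eta (y (p + j)%N w - g w) * dB (p + j)%N w.
(* The residual integrand. [Jt] and [Js] come with unrelated approximations [S] and [S'], which fail
   to cancel before [s]; after [s] the residual is what the truncation removes. *)
pose rr j w := if (j < p)%N then y j w - y' j w else
   (y j w - g w) - clip eta (y j w - g w).
have my j : (j < n)%N ->
    measurable_fun setT (y j : g_sigma_algebraType (F (tau j)) -> R).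
  move=> jn; have tj := tau_ge0 j (ltnW jn); apply/measurable_wrtP => //.
  by have := sp_eval_measurable_wrt gapS jn tj.
have my' j : (j < n)%N ->
    measurable_fun setT (y' j : g_sigma_algebraType (F (tau j)) -> R).
  move=> jn; have tj := tau_ge0 j (ltnW jn); apply/measurable_wrtP => //.
  by have := sp_eval_measurable_wrt gapS' jn tj.
have myg j : (p <= j < n)%N -> measurable_fun setT
    ((fun w => y j w - g w) : g_sigma_algebraType (F (tau j)) -> R).
  move=> /andP[pj jn]; apply: measurable_funB; first exact: my.
  by apply/measurable_wrtP; [exact/tau_ge0/ltnW|apply: mg; rewrite pj ltnW].
have mrr j : (j < n)%N -> measurable_wrt (F (tau j)) (rr j).
  move=> jn; have tj := tau_ge0 j (ltnW jn); apply/measurable_wrtP => //.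
  rewrite /rr; case: ltnP => [jp|pj].
    by apply: measurable_funB; [exact: my|exact: my'].
  apply: measurable_funB; last apply: measurable_fun_clip.
    by apply: myg; rewrite pj.
  by apply: myg; rewrite pj.
have [N0 [mN0 PN0 HN0]] :=
  stochastic_sum_small hB (tau_ge0 0%N (leq0n _)) ltt mrr (ltW b0) k30.
pose taus j := tau (p + j)%N.
have taus0 : taus 0%N = s by rewrite /taus addn0.
have tausm : taus m = t by rewrite /taus -nE.
have pjn j : (j < m)%N -> (p <= p + j < n)%N by move=> jm; rewrite leq_addr nE ltn_add2l.
have ltts j : (j < m)%N -> taus j < taus j.+1.
  by move=> jm; rewrite /taus addnS; apply: ltt; have /andP[] := pjn j jm.
(* As [phi] does not vary over [(s, t]], [phi * (B t - B s)] telescopes over the grid, and together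
   with [rho] it forms one stochastic sum: a single isometry covers both, with no cross term to
   estimate. *)
pose gs (phi : T -> R) j w := phi w + clip eta (y (p + j)%N w - g w).
have rhoE (X phi : T -> R) :
    (fun w => X w + phi w * (B t w - B s w) + rho w) =
    (fun w => X w + \sum_(j < m) gs phi j w * (B (taus j.+1) w - B (taus j) w)).
  apply/funext => w; rewrite -addrA; congr (_ + _).
  rewrite /gs; under [RHS]eq_bigr do rewrite mulrDl.
  rewrite big_split/= -mulr_sumr; congr (_ * _ + _).
    rewrite -(big_mkord xpredT (fun j => B (taus j.+1) w - B (taus j) w)).
    by rewrite (telescope_sumr (fun j => B (taus j) w))// tausm taus0.
  by apply: eq_bigr => j _; rewrite /taus addnS.
have sm (X phi : T -> R) : measurable_wrt (F s) X -> measurable_wrt (F s) phi ->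
  measurable_wrt (F t) (fun w => X w + phi w * (B t w - B s w) + rho w) /\
  (second_moment P (fun w => X w + phi w * (B t w - B s w) + rho w)%R =
    second_moment P X +
      \sum_(j < m) (taus j.+1 - taus j)%:E * second_moment P (gs phi j))%E.
  move=> mX mphi; rewrite rhoE -tausm.
  apply: (second_moment_sum hB) => //; rewrite ?taus0// => j jm.
  have /andP[pj pjm] := pjn j jm.
  have tj : 0 <= taus j by apply/tau_ge0/ltnW.
  apply/measurable_wrtP => //; apply: measurable_funD.
    apply/measurable_wrtP => //; apply: measurable_wrt_le mphi => //.
    by rewrite -taup; apply: tau_le; rewrite pj ltnW.
  by apply: measurable_fun_clip; apply: myg; rewrite pj.
exists rho, (N0 `|` N1 `|` N2 `|` N3 `|` N4); split.
- have m0 := measurable_wrt_cst F 0 s0.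
  have [+ _] := sm (cst 0) (cst 0) m0 m0.
  by congr (measurable_wrt _ _); apply/funext => w; rewrite /cst mul0r !add0r.
- move=> X phi mX mphi; have [_ ->] := sm X phi mX mphi.
  apply: leeD => //.
  set C := (_ + _)%E.
  have C0 : (0 <= C)%E.
    apply: adde_ge0; last by rewrite lee_fin mulr_ge0 ?sqr_ge0// addr_ge0// invr_ge0 ltW.
    apply: mule_ge0; first by rewrite lee_fin addr_ge0// ltW.
    by apply: integral_ge0 => w _; rewrite lee_fin sqr_ge0.
  apply: (@le_trans _ _ (\sum_(j < m) (taus j.+1 - taus j)%:E * C)%E).
    apply: lee_sum => j _; apply: lee_wpmul2l.
      by rewrite lee_fin subr_ge0 ltW// ltts.
    rewrite [leLHS](_ : _ = second_moment P
      (fun w => phi w + clip eta (y (p + j)%N w - g w))%R)//.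
    apply: second_moment_addD => //.
    + exact: (measurable_wrt_measurable s0 mphi).
    + apply: measurable_fun_clip.
      have /andP[pj pjm] := pjn j (ltn_ord j).
      apply: (measurable_wrt_measurable (tau_ge0 _ (ltnW pjm))).
      by apply/measurable_wrtP; [exact/tau_ge0/ltnW|apply: myg; rewrite pj].
    + by move=> w; apply: clip_bound; exact: ltW.
  rewrite -ge0_sume_distrl; last by move=> j _; rewrite lee_fin subr_ge0 ltW// ltts.
  rewrite sumEFin -(big_mkord xpredT (fun j => taus j.+1 - taus j)).
  by rewrite telescope_sumr// tausm taus0.
- by repeat apply: measurableU.
- have -> : eps = e5 + e5 + e5 + e5 + e5 by rewrite /e5; field.
  do 4?[apply: probability_setU_le => //]; try by repeat apply: measurableU.
  by apply: le_trans PN0 _; rewrite /b mulfK// expf_neq0// gt_eqF.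
- move=> w Nw osc.
  have Nw0 : ~ N0 w by move=> h; apply: Nw; do 4 left.
  have Nw1 : ~ N1 w by move=> h; apply: Nw; do 3 left; right.
  have Nw2 : ~ N2 w by move=> h; apply: Nw; do 2 left; right.
  have Nw3 : ~ N3 w by move=> h; apply: Nw; left; right.
  have Nw4 : ~ N4 w by move=> h; apply: Nw; right.
  have I1 : (\int[mu]_(r in `[0%R, t]) square_error H S (r, w) <= (b / 4)%:E)%E.
    move: Nw1 => /negP; rewrite -ltNge /cst sube0 gee0_abs; first exact: ltW.
    by apply: integral_ge0 => r _; rewrite lee_fin sqr_ge0.
  have I2 : (\int[mu]_(r in `[0%R, s]) square_error H S' (r, w) <= (b / 4)%:E)%E.
    move: Nw2 => /negP; rewrite -ltNge /cst sube0 gee0_abs; first exact: ltW.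
    by apply: integral_ge0 => r _; rewrite lee_fin sqr_ge0.
  have le_b : \sum_(j < n) rr j w ^+ 2 * (tau j.+1 - tau j) <= b.
    rewrite -lee_fin.
    have osc' r : tau p <= r <= tau n -> `|H r w - H (tau p) w| <= eta.
      by rewrite taup taun; exact: osc.
    have := sum_sqr_le_square_error iH (ltW eta0) tau0 pn ltt gapS gapS' osc'.
    rewrite taup taun => /le_trans; apply.
    have -> : b%:E = (2%:E * (b / 4)%:E + 2%:E * (b / 4)%:E)%E.
      by rewrite -!EFinM -EFinD; congr EFin; field.
    by apply: leeD; apply: lee_wpmul2l.
  have := HN0 w Nw0 le_b.
  have -> : \sum_(j < n) rr j w * (B (tau j.+1) w - B (tau j) w) =
     sp_integral B S t w - sp_integral B S' s w - g w * (B t w - B s w) - rho w.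
    rewrite -{1}taun -{1}taup (sp_integralE B tau0 ltt gapS w (leqnn n)).
    rewrite (sp_integralE B tau0 ltt gapS' w pn).
    have -> : g w * (B t w - B s w) =
        \sum_(j < m) g w * dB (p + j)%N w.
      rewrite -mulr_sumr -(big_mkord xpredT (fun j => dB (p + j)%N w)).
      rewrite (eq_bigr (fun j => B (taus j.+1) w - B (taus j) w)); last first.
        by move=> j _; rewrite /dB /taus addnS.
      by rewrite (telescope_sumr (fun j => B (taus j) w))// tausm taus0.
    rewrite -(big_mkord xpredT (fun j => rr j w * (B (tau j.+1) w - B (tau j) w))).
    rewrite -(big_mkord xpredT
      (fun j => sp_eval S (tau j.+1) w * (B (tau j.+1) w - B (tau j) w))).
    rewrite !(@big_cat_nat _ _ _ p 0 n)//= !big_mkord.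
    have shift (f : nat -> R) : \sum_(p <= j < n) f j = \sum_(j < m) f (p + j)%N.
      rewrite -[X in \sum_(X <= _ < _) _]add0n big_addn big_mkord.
      by apply: eq_bigr => j _; rewrite addnC.
    rewrite !shift.
    have -> : \sum_(j < p) rr j w * (B (tau j.+1) w - B (tau j) w) =
        \sum_(j < p) y j w * dB j w - \sum_(j < p) y' j w * dB j w.
      by rewrite -sumrB; apply: eq_bigr => j _; rewrite /rr ltn_ord mulrBl.
    have -> : \sum_(j < m) rr (p + j)%N w * dB (p + j)%N w =
        \sum_(j < m) y (p + j)%N w * dB (p + j)%N w -
        \sum_(j < m) g w * dB (p + j)%N w - rho w.
      rewrite -!sumrB; apply: eq_bigr => j _.
      by rewrite /rr ltnNge leq_addr/= !mulrBl.
    rewrite /y /y' /dB; ring.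
  move=> h.
  have h3 : `|sp_integral B S t w - Jt w| < k3.
    by move: Nw3 => /negP; rewrite -ltNge -EFinB abse_EFin lte_fin.
  have h4 : `|sp_integral B S' s w - Js w| < k3.
    by move: Nw4 => /negP; rewrite -ltNge -EFinB abse_EFin lte_fin.
  have -> : kappa = k3 + k3 + k3 by rewrite /k3; field.
  rewrite -/g; move: h h3 h4; rewrite !ltr_norml ler_norml.
  by move=> /andP[? ?] /andP[? ?] /andP[? ?]; apply/andP; split; lra.
Unshelve. all: by end_near. Qed.

End increment.

(** * Modulus of continuity of the paths *)

Lemma within_continuous_half_line {R : realType} (f : R -> R) :
  {within `[0, +oo[, continuous f} ->
  forall r e : R, 0 <= r -> 0 < e ->
    exists2 del : R, 0 < del & forall q : R, 0 <= q -> `|q - r| < del -> `|f q - f r| < e.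
Proof.
move=> /subspace_continuousP cf r e r0 e0.
have rI : `[0, +oo[%classic r by rewrite /= in_itv/= r0.
have /cvgrPdist_lt /(_ e e0) := cf r rI.
rewrite /within/= => /nbhs_ballP[del /= del0 h].
exists del => // q q0 qr.
by rewrite distrC; apply: h; rewrite /ball/= ?(distrC r)// in_itv/= q0.
Qed.

Lemma within_continuous_uniform {R : realType} (f : R -> R) (M e : R) :
  {within `[0, +oo[, continuous f} -> 0 < e ->
  exists2 del : R, 0 < del & forall r q : R, 0 <= r <= M -> 0 <= q -> `|q - r| < del ->
    `|f q - f r| < e.
Proof.
move=> cf e0; have cf' := within_continuous_half_line cf.
pose Q (del r : R) := 0 <= r ->
  forall q : R, 0 <= q -> `|q - r| < del -> `|f q - f r| < e.
have : \forall del \near 0^'+, `[0, M]%classic `<=` Q del.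
  have /compact_near_coveringP := @segment_compact R 0 M.
  apply => r /=; rewrite in_itv/= => /andP[r0 _].
  have [del del0 h] := cf' r _ r0 (divr_gt0 e0 (ltr0Sn _ 1)).
  near=> x d' => /= x0 q q0 qx.
  have -> : f q - f x = (f q - f r) - (f x - f r) by ring.
  rewrite (splitr e); apply: le_lt_trans (ler_normB _ _) _.
  have xr : `|x - r| < del / 2.
    rewrite distrC; near: x; apply/nbhs_ballP; exists (del / 2) => //=.
    by rewrite divr_gt0.
  apply: ltrD; apply: h => //.
  have -> : q - r = (q - x) + (x - r) by ring.
  rewrite (splitr del); apply: le_lt_trans (ler_normD _ _) _; apply: ltrD => //.
  apply: lt_trans qx _; near: d'.
  by apply: nbhs_right_lt; rewrite divr_gt0.
move=> Qn; near (0 : R)^'+ => del.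
have del0 : 0 < del by near: del; exact: nbhs_right_gt.
have Qd : `[0, M]%classic `<=` Q del by near: del.
exists del => // r q rM; apply: (Qd r) => //.
by case/andP: rM.
Unshelve. all: by end_near. Qed.

(** Each continuous path has its own modulus; continuity from above of [P] yields a common one off a
    small event. Testing rational times only makes the bad events countable unions, hence
    measurable, and by continuity of the path every violation is witnessed by a rational pair. *)
Lemma modulus_of_continuity {d} {T : measurableType d} {R : realType}
    (P : probability T R) (X : R -> T -> R) (M eta eps : R) :
  (forall t, 0 <= t -> measurable_fun setT (X t)) ->
  continuous_paths P X -> 0 < eta -> 0 < eps ->
  exists (del : R) (N : set T), [/\ 0 < del, measurable N, (P N <= eps%:E)%E &
    forall w, ~ N w -> {within `[0, +oo[, continuous (X ^~ w)} /\
      (forall r q, 0 <= r <= M -> 0 <= q <= M -> `|q - r| < del ->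
         `|X q w - X r w| <= eta)].
Proof.
move=> mX [N0 [mN0 PN0 subN0]] eta0 eps0.
have cN0 w : ~ N0 w -> {within `[0, +oo[, continuous (X ^~ w)}.
  by move=> h; apply: contrapT => h'; apply: h; apply: subN0.
(* The window is [[0, M + 1]] because rational witnesses are taken slightly to the right of the
   original times and may pass [M]. *)
pose bad k (r q : R) := [set w | [/\ 0 <= r <= M + 1, 0 <= q <= M + 1,
   `|q - r| < k.+1%:R^-1 & eta < `|X q w - X r w|]].
have mbad k r q : measurable (bad k r q).
  have [h|h] := pselect
    [/\ 0 <= r <= M + 1, 0 <= q <= M + 1 & `|q - r| < k.+1%:R^-1]; last first.
    rewrite [X in measurable X](_ : _ = set0); first exact: measurable0.
    by apply/seteqP; split => // w [? ? ? _]; apply: h.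
  rewrite [X in measurable X](_ : _ = ~` [set w | `|X q w - X r w| <= eta]).
    apply: measurableC; apply: measurable_set_ler => //.
    case: h => /andP[r0 _] /andP[q0 _] _.
    by apply: measurableT_comp => //; apply: measurable_funB; exact: mX.
  case: h => h1 h2 h3.
  apply/seteqP; split => w /=; first by move=> [_ _ _]; rewrite ltNge => /negP.
  by move=> /negP; rewrite -ltNge => h4; split.
pose A k := \bigcup_(a in [set: rat]) \bigcup_(b in [set: rat]) bad k (ratr a) (ratr b).
have mA k : measurable (A k).
  by apply: bigcupT_measurable_rat => a; apply: bigcupT_measurable_rat => b.
have niA : nonincreasing_seq A.
  apply/nonincreasing_seqP => k; rewrite subsetEset.
  move=> w [a _ [b _ [h1 h2 h3 h4]]]; exists a => //; exists b => //; split => //.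
  by apply: lt_trans h3 _; rewrite ltf_pV2 ?posrE// ltr_nat.
(* A continuous path is uniformly continuous on [[0, M + 1]], so a path that violates the bound at
   every scale belongs to the null set [N0]. *)
have capA : \bigcap_k A k `<=` N0.
  move=> w Aw; apply: contrapT => /cN0 cw.
  have [del del0 h] := within_continuous_uniform (M + 1) cw eta0.
  have [k kd] : exists k, k.+1%:R^-1 < del.
    exists (Num.truncn del^-1).
    by rewrite invf_plt ?posrE// truncnS_gt// invr_ge0 ltW.
  have [a _ [b _ [h1 /andP[h2 _] h3 h4]]] := Aw k I.
  by have := lt_trans h4 (h _ _ h1 h2 (lt_trans h3 kd)); rewrite ltxx.
have mcapA : measurable (\bigcap_k A k) by exact: bigcapT_measurable.
have PcapA : P (\bigcap_k A k) = 0%E.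
  apply/eqP; rewrite eq_le measure_ge0 andbT.
  apply: (@le_trans _ _ (P N0)); last by rewrite PN0.
  by apply: le_measure; rewrite ?inE.
have : (P \o A) @ \oo --> P (\bigcap_k A k).
  apply: nonincreasing_cvg_mu => //.
  by apply: le_lt_trans (probability_le1 P (mA 0%N)) _; rewrite ltry.
rewrite PcapA => cPA.
have [k Pk] : exists k, (P (A k) < eps%:E)%E.
  have /filter_ex[k Pk] : \forall k \near \oo, (P (A k) < eps%:E)%E.
    apply: (cPA [set x | (x < eps%:E)%E]); apply: open_nbhs_nbhs.
    by split; [exact: open_ereal_lt_ereal|rewrite /= lte_fin].
  by exists k.
exists k.+1%:R^-1, (A k `|` N0); split => //.
- exact: measurableU.
- rewrite -[eps]addr0; apply: probability_setU_le => //; first exact: ltW.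
  by rewrite PN0.
move=> w /not_orP[nA nN0]; have cw := cN0 w nN0; split => // r q rM qM qr.
rewrite leNgt; apply/negP => Xqr; apply: nA.
(* [gam] is half of the excess over [eta]: moving both times changes [X] by less than [gam] each, so
   the violation stays strict. [sig] is the room left by the strict bound on [|q - r|]. *)
pose gam := (`|X q w - X r w| - eta) / 2.
have gam0 : 0 < gam by rewrite divr_gt0// subr_gt0.
pose sig := k.+1%:R^-1 - `|q - r|.
have sig0 : 0 < sig by rewrite subr_gt0.
have /andP[r0 rM'] := rM; have /andP[q0 qM'] := qM.
have hc := within_continuous_half_line cw.
have [dr dr0 hr] := hc r gam r0 gam0; have [dq dq0 hq] := hc q gam q0 gam0.
pose sg := Num.min (Num.min dr dq) (Num.min sig 1).
have sg0 : 0 < sg by rewrite !lt_min dr0 dq0 sig0 ltr01.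
have [sgr sgq sgs sg1] : [/\ sg <= dr, sg <= dq, sg <= sig & sg <= 1].
  by rewrite /sg !ge_min !lexx !orbT.
have [a] : exists a : rat, ratr a \in `]r, r + sg[ by apply: rat_in_itvoo; rewrite ltrDl.
rewrite in_itv/= => /andP[ra ars].
have [b] : exists b : rat, ratr b \in `]q, q + sg[ by apply: rat_in_itvoo; rewrite ltrDl.
rewrite in_itv/= => /andP[qb bqs].
exists a => //; exists b => //; split.
- by apply/andP; split; lra.
- by apply/andP; split; lra.
- have h1 : q - r <= `|q - r| by exact: ler_norm.
  have h2 : - (q - r) <= `|q - r| by rewrite -normrN; exact: ler_norm.
  move: sgs; rewrite /sig; move: (k.+1%:R^-1) => z sgz.
  by rewrite ltr_norml; apply/andP; split; lra.
- have xa : `|X (ratr a) w - X r w| < gam.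
    by apply: hr; [lra|rewrite ger0_norm; lra].
  have xb : `|X (ratr b) w - X q w| < gam.
    by apply: hq; [lra|rewrite ger0_norm; lra].
  have -> : eta = `|X q w - X r w| - gam - gam by rewrite /gam; field.
  have : `|X q w - X r w| <= `|X (ratr b) w - X (ratr a) w| +
      (`|X (ratr b) w - X q w| + `|X (ratr a) w - X r w|).
    have -> : X q w - X r w = (X (ratr b) w - X (ratr a) w) +
       (- (X (ratr b) w - X q w) + (X (ratr a) w - X r w)) by ring.
    apply: le_trans (ler_normD _ _) _; rewrite lerD2l.
    by apply: le_trans (ler_normD _ _) _; rewrite normrN.
  by lra.
Qed.

(** * The perturbed Euler scheme *)

Lemma Rintegral_increment {R : realType} (f : R -> R) (s t c eta : R) :
  {within `[0, +oo[, continuous f} -> 0 <= s -> s < t ->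
  (forall r, s <= r <= t -> `|f r - c| <= eta) ->
  `|\int[lebesgue_measure]_(r in `[0%R, t]) f r -
    \int[lebesgue_measure]_(r in `[0%R, s]) f r - (t - s) * c| <= eta * (t - s).
Proof.
move=> cf s0 st osc.
have t0 : 0 <= t := le_trans s0 (ltW st).
have int (g : R -> R) a b : {within `[0, +oo[, continuous g} -> 0 <= a ->
    lebesgue_measure.-integrable `[a, b]%classic (EFin \o g).
  move=> cg a0; apply: continuous_compact_integrable; first exact: segment_compact.
  apply: continuous_subspaceW cg => r /=; rewrite !in_itv/= => /andP[+ _].
  by move=> /(le_trans a0) ->.
have cc (a : R) : {within `[0, +oo[, continuous (cst a : R -> R)}.
  by apply: continuous_subspaceT => x; exact: cst_continuous.
have cfc : {within `[0, +oo[, continuous (fun r => f r - c)}.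
  by move=> x; apply: cvgB; [exact: cf|exact: cc].
have -> : \int[lebesgue_measure]_(r in `[0%R, t]) f r -
    \int[lebesgue_measure]_(r in `[0%R, s]) f r =
    \int[lebesgue_measure]_(r in `[s, t]) f r.
  rewrite Rintegral_itvB ?bnd_simp//; [|exact: int|exact: ltW].
  apply: Rintegral_itv_obnd_cbnd.
  by apply: integrableS (int f s t cf s0) => //; apply: subset_itvr; rewrite bnd_simp.
have -> : (t - s) * c = \int[lebesgue_measure]_(r in `[s, t]) c.
  by rewrite Rintegral_cst//= lebesgue_measure_itv/= lte_fin st/= mulrC.
rewrite -RintegralB//; [|exact: int|exact: (int (cst c))].
apply: le_trans (le_normr_Rintegral _ _) _ => //; first exact: (int (fun r => f r - c)).
have -> : eta * (t - s) = \int[lebesgue_measure]_(r in `[s, t]) eta.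
  by rewrite Rintegral_cst//= lebesgue_measure_itv/= lte_fin st.
apply: le_Rintegral => //.
- apply: (int (fun r => `|f r - c|)) => // x.
  by apply: cvg_norm; exact: cfc.
- exact: (int (cst eta)).
Qed.

Lemma fin_num_le_EFin {R : realType} (x : \bar R) (r : R) :
  (0 <= x)%E -> (x <= r%:E)%E -> x \is a fin_num.
Proof. by move=> x0 xr; rewrite ge0_fin_numE// (le_lt_trans xr)// ltry. Qed.

(** A finite bound on a positive combination forces both terms to be finite, which lets the
    estimates of [euler_step] continue in [R]. *)
Lemma lincomb_le_EFin {R : realType} (p r : R) (x y : \bar R) : 0 < p ->
  (0 <= x)%E -> (0 <= y)%E -> (p%:E * x + y <= r%:E)%E ->
  exists a b : R, [/\ x = a%:E, y = b%:E, 0 <= a, 0 <= b & p * a + b <= r].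
Proof.
move=> p0 x0 y0 h.
have px0 : (0 <= p%:E * x)%E by rewrite mule_ge0// lee_fin ltW.
have yf : y \is a fin_num.
  by apply: fin_num_le_EFin y0 (le_trans _ h); rewrite leeDr.
have xf : x \is a fin_num.
  have pxf : (p%:E * x)%E \is a fin_num.
    by apply: fin_num_le_EFin px0 (le_trans _ h); rewrite leeDl.
  move: x0 pxf {h px0}; case: x => [x|//|//] _ //=.
  by rewrite gt0_muley// lte_fin.
exists (fine x), (fine y); rewrite !fineK//; split => //; rewrite ?fine_ge0//.
by rewrite -lee_fin EFinD EFinM !fineK.
Qed.

Section euler.
Context {R : realType} {d : measure_display} {T : measurableType d}.
Context (P : probability T R).

Lemma second_moment_ge0 (X : T -> R) : (0 <= second_moment P X)%E.
Proof. by apply: integral_ge0 => w _; rewrite lee_fin sqr_ge0. Qed.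

Lemma second_moment_lincomb (X Y : T -> R) (p : R) : 0 <= p ->
  measurable_fun setT X -> measurable_fun setT Y ->
  (\int[P]_w (p * X w ^+ 2 + Y w ^+ 2)%:E =
   p%:E * second_moment P X + second_moment P Y)%E.
Proof.
move=> p0 mX mY.
under eq_integral do rewrite EFinD EFinM.
rewrite ge0_integralD//=.
- rewrite ge0_integralZl//.
  + by apply/measurable_EFinP; exact: measurable_funX.
  + by move=> w _; rewrite lee_fin sqr_ge0.
- by move=> w _; rewrite -EFinM lee_fin mulr_ge0 ?sqr_ge0.
- by apply: emeasurable_funM => //; apply/measurable_EFinP; exact: measurable_funX.
- by move=> w _; rewrite lee_fin sqr_ge0.
- by apply/measurable_EFinP; exact: measurable_funX.
Qed.

Variables (a11 a12 a21 a22 b11 b12 b21 b22 p K : R).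
Let f1 (x y : R) := a11 * x + a12 * y.
Let f2 (x y : R) := a21 * x + a22 * y.
Let g1 (x y : R) := b11 * x + b12 * y.
Let g2 (x y : R) := b21 * x + b22 * y.
Hypothesis p0 : 0 < p.
Hypothesis K0 : 0 <= K.
Hypothesis lyapunov : forall x y,
  2 * (p * x * f1 x y + y * f2 x y) + (p * g1 x y ^+ 2 + g2 x y ^+ 2) <= 0.
Hypothesis Kf : forall x y, p * f1 x y ^+ 2 + f2 x y ^+ 2 <= K * (p * x ^+ 2 + y ^+ 2).
Hypothesis Kg : forall x y, p * g1 x y ^+ 2 + g2 x y ^+ 2 <= K * (p * x ^+ 2 + y ^+ 2).

(** Expanding [V(x + h f) + h V(g)], the first order term is [h] times the generator, hence
    nonpositive, and [h^2 V(f)] remains; [h <= eta] turns it into a term of order [eta h]. The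
    surplus [eta h V(g)] and the remainders have that order too. *)
Lemma euler_step (h eta v : R) (Z1 Z2 M1 M2 r1 r2 : T -> R) :
  0 < h -> h <= eta -> eta <= 1 ->
  measurable_fun setT Z1 -> measurable_fun setT Z2 ->
  measurable_fun setT M1 -> measurable_fun setT M2 ->
  measurable_fun setT r1 -> measurable_fun setT r2 ->
  (forall w, `|r1 w| <= 2 * eta * h) -> (forall w, `|r2 w| <= 2 * eta * h) ->
  (second_moment P M1 <= second_moment P (fun w => Z1 w + h * f1 (Z1 w) (Z2 w))%R +
    h%:E * ((1 + eta)%:E * second_moment P (fun w => g1 (Z1 w) (Z2 w)) +
      ((1 + eta^-1) * eta ^+ 2)%:E))%E ->
  (second_moment P M2 <= second_moment P (fun w => Z2 w + h * f2 (Z1 w) (Z2 w))%R +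
    h%:E * ((1 + eta)%:E * second_moment P (fun w => g2 (Z1 w) (Z2 w)) +
      ((1 + eta^-1) * eta ^+ 2)%:E))%E ->
  (p%:E * second_moment P Z1 + second_moment P Z2 <= v%:E)%E ->
  (p%:E * second_moment P (fun w => M1 w + r1 w)%R +
     second_moment P (fun w => M2 w + r2 w)%R + 1 <=
    ((1 + (1 + 4 * K + 12 * (p + 1)) * (eta * h)) * (v + 1))%:E)%E.
Proof.
move=> h0 heta eta1 mZ1 mZ2 mM1 mM2 mr1 mr2 r1b r2b.
have eta0 : 0 < eta by apply: lt_le_trans heta.
have mf1 : measurable_fun setT (fun w => f1 (Z1 w) (Z2 w)).
  by apply: measurable_funD; apply: measurable_funM.
have mf2 : measurable_fun setT (fun w => f2 (Z1 w) (Z2 w)).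
  by apply: measurable_funD; apply: measurable_funM.
have mg1 : measurable_fun setT (fun w => g1 (Z1 w) (Z2 w)).
  by apply: measurable_funD; apply: measurable_funM.
have mg2 : measurable_fun setT (fun w => g2 (Z1 w) (Z2 w)).
  by apply: measurable_funD; apply: measurable_funM.
have ma1 : measurable_fun setT (fun w => Z1 w + h * f1 (Z1 w) (Z2 w)).
  by apply: measurable_funD => //; apply: measurable_funM.
have ma2 : measurable_fun setT (fun w => Z2 w + h * f2 (Z1 w) (Z2 w)).
  by apply: measurable_funD => //; apply: measurable_funM.
have eh0 : 0 < eta * h by rewrite mulr_gt0.
have R1 := second_moment_addD P eh0 mM1 mr1 r1b.
have R2 := second_moment_addD P eh0 mM2 mr2 r2b.
have mV (X Y : T -> R) : measurable_fun setT X -> measurable_fun setT Y ->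
    measurable_fun setT (fun w => (p * X w ^+ 2 + Y w ^+ 2)%:E).
  move=> mX mY; apply/measurable_EFinP/measurable_funD; last exact: measurable_funX.
  by apply: measurable_funM => //; exact: measurable_funX.
have V0 (x y : R) : 0 <= p * x ^+ 2 + y ^+ 2.
  by rewrite addr_ge0 ?sqr_ge0// mulr_ge0 ?sqr_ge0// ltW.
have V0e (x y : R) : (0 <= (p * x ^+ 2 + y ^+ 2)%:E)%E by rewrite lee_fin.
have mVg := mV _ _ mg1 mg2; have mVz := mV _ _ mZ1 mZ2; have mVa := mV _ _ ma1 ma2.
have Va : (p%:E * second_moment P (fun w => Z1 w + h * f1 (Z1 w) (Z2 w))%R +
    second_moment P (fun w => Z2 w + h * f2 (Z1 w) (Z2 w))%R +
  h%:E * (p%:E * second_moment P (fun w => g1 (Z1 w) (Z2 w)) +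
     second_moment P (fun w => g2 (Z1 w) (Z2 w))) <=
  (1 + K * h ^+ 2)%:E * (p%:E * second_moment P Z1 + second_moment P Z2))%E.
  rewrite -!second_moment_lincomb ?(ltW p0)//.
  have c0 : 0 <= 1 + K * h ^+ 2 by rewrite addr_ge0// mulr_ge0 ?sqr_ge0.
  rewrite -ge0_integralZl//=; last by rewrite lee_fin ltW.
  rewrite -ge0_integralZl//=.
  rewrite -ge0_integralD//=; last 2 first.
  - by move=> w _; rewrite -EFinM lee_fin mulr_ge0// ltW.
  - by apply: emeasurable_funM.
  apply: ge0_le_integral => //=.
  - by move=> w _; rewrite -EFinM -EFinD lee_fin addr_ge0// mulr_ge0// ltW.
  - by apply: emeasurable_funD => //; apply: emeasurable_funM.
  - by apply: emeasurable_funM.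
  move=> w _; rewrite -!EFinM -EFinD lee_fin.
  move: (Z1 w) (Z2 w) => x y.
  have L := lyapunov x y; have KF := Kf x y.
  rewrite -subr_ge0.
  have -> : (1 + K * h ^+ 2) * (p * x ^+ 2 + y ^+ 2) -
     (p * (x + h * f1 x y) ^+ 2 + (y + h * f2 x y) ^+ 2 +
        h * (p * g1 x y ^+ 2 + g2 x y ^+ 2)) =
     h * - (2 * (p * x * f1 x y + y * f2 x y) + (p * g1 x y ^+ 2 + g2 x y ^+ 2)) +
     h ^+ 2 * (K * (p * x ^+ 2 + y ^+ 2) - (p * f1 x y ^+ 2 + f2 x y ^+ 2)) by ring.
  by rewrite addr_ge0// mulr_ge0 ?sqr_ge0 ?(ltW h0)// ?oppr_ge0// subr_ge0.
have Vg : (p%:E * second_moment P (fun w => g1 (Z1 w) (Z2 w)) +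
     second_moment P (fun w => g2 (Z1 w) (Z2 w)) <=
  K%:E * (p%:E * second_moment P Z1 + second_moment P Z2))%E.
  rewrite -!second_moment_lincomb ?(ltW p0)//.
  rewrite -ge0_integralZl//=.
  apply: ge0_le_integral => //=.
  - by apply: emeasurable_funM.
  - by move=> w _; rewrite -EFinM lee_fin.
move=> H1 H2 Hv; move: R1 R2 Va Vg H1 H2.
have [z1 [z2 [-> -> z10 z20 zv]]] :=
  lincomb_le_EFin p0 (second_moment_ge0 Z1) (second_moment_ge0 Z2) Hv.
set s1 := second_moment P (fun w => M1 w + r1 w)%R.
set s2 := second_moment P (fun w => M2 w + r2 w)%R.
have s10 : (0 <= s1)%E by exact: second_moment_ge0.
have s20 : (0 <= s2)%E by exact: second_moment_ge0.
move: (second_moment_ge0 M1) (second_moment_ge0 M2).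
move: (second_moment P M1) (second_moment P M2) => m1 m2 m10 m20.
set x1 := second_moment P (fun w => Z1 w + _)%R.
set x2 := second_moment P (fun w => Z2 w + _)%R.
have x10 : (0 <= x1)%E by exact: second_moment_ge0.
have x20 : (0 <= x2)%E by exact: second_moment_ge0.
set y1 := second_moment P (fun w => g1 _ _)%R.
set y2 := second_moment P (fun w => g2 _ _)%R.
have y10 : (0 <= y1)%E by exact: second_moment_ge0.
have y20 : (0 <= y2)%E by exact: second_moment_ge0.
move: s1 s2 x1 x2 y1 y2 s10 s20 x10 x20 y10 y20.
move=> s1 s2 x1 x2 y1 y2 s10 s20 x10 x20 y10 y20.
have -> : (p%:E * z1%:E + z2%:E = (p * z1 + z2)%:E)%E by [].
rewrite -!EFinM => R1 R2 Va Vg.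
have [y1' [y2' [y1E y2E y1'0 y2'0 {}Vg]]] := lincomb_le_EFin p0 y10 y20 Vg.
have Vx : (p%:E * x1 + x2 <= ((1 + K * h ^+ 2) * (p * z1 + z2))%:E)%E.
  apply: le_trans Va; rewrite leeDl// mule_ge0// ?lee_fin ?(ltW h0)//.
  by rewrite adde_ge0// mule_ge0// lee_fin ltW.
have [x1' [x2' [x1E x2E x1'0 x2'0 _]]] := lincomb_le_EFin p0 x10 x20 Vx.
have {}Va : p * x1' + x2' + h * (p * y1' + y2') <= (1 + K * h ^+ 2) * (p * z1 + z2).
  by rewrite -lee_fin; move: Va; rewrite x1E x2E y1E y2E.
move=> H1 H2; rewrite x1E y1E in H1; rewrite x2E y2E in H2.
have m1f := fin_num_le_EFin m10 H1; have m2f := fin_num_le_EFin m20 H2.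
move: H1 H2 R1 R2; rewrite -(fineK m1f) -(fineK m2f).
move: (fine m1) (fine m2) => n1 n2 H1 H2 R1 R2.
rewrite lee_fin in H1; rewrite lee_fin in H2.
apply: (@le_trans _ _
  (p * ((1 + eta * h) * n1 + (1 + (eta * h)^-1) * (2 * eta * h) ^+ 2) +
   ((1 + eta * h) * n2 + (1 + (eta * h)^-1) * (2 * eta * h) ^+ 2) + 1)%:E).
  rewrite EFinD; apply: leeD => //; rewrite EFinD; apply: leeD => //.
  by rewrite EFinM lee_wpmul2l// lee_fin ltW.
rewrite lee_fin.
have E1 : (1 + (eta * h)^-1) * (2 * eta * h) ^+ 2 = 4 * (eta * h) ^+ 2 + 4 * (eta * h).
  by field; rewrite !gt_eqF.
have E2 : (1 + eta^-1) * eta ^+ 2 = eta ^+ 2 + eta by field; rewrite gt_eqF.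
rewrite E1; rewrite E2 in H1 H2.
pose q := eta * h.
pose W := p * z1 + z2.
have W0 : 0 <= W by rewrite addr_ge0// mulr_ge0// ltW.
have q1 : q <= 1 by rewrite /q mulr_ile1// ?(ltW eta0) ?(ltW h0)// (le_trans heta).
have hq : h ^+ 2 <= q by rewrite expr2 ler_wpM2r// ltW.
have ee : eta ^+ 2 <= eta by rewrite expr2 ler_piMl// ltW.
(* One [K * q * W] comes from [h ^+ 2 <= q], the other from the factor [1 + eta] in front of [V(g)];
   [2 * q * (p + 1)] comes from [eta ^+ 2 + eta <= 2 * eta]. *)
have Hn : p * n1 + n2 <= (1 + 2 * K * q) * W + 2 * q * (p + 1).
  have h1 : p * n1 <= p * (x1' + h * ((1 + eta) * y1' + (eta ^+ 2 + eta))).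
    by rewrite ler_wpM2l// ltW.
  have h2 : q * (p * y1' + y2') <= q * (K * W) by rewrite ler_wpM2l// ltW.
  have h3 : h * (p + 1) * (eta ^+ 2 + eta) <= h * (p + 1) * (2 * eta).
    apply: ler_wpM2l; last by lra.
    by rewrite mulr_ge0 ?(ltW h0)// addr_ge0// ltW.
  have h4 : K * h ^+ 2 * W <= K * q * W by rewrite ler_wpM2r// ler_wpM2l.
  have -> : (1 + 2 * K * q) * W + 2 * q * (p + 1) =
    W + K * q * W + q * (K * W) + h * (p + 1) * (2 * eta) by rewrite /q; ring.
  have V1 : p * x1' + x2' + h * (p * y1' + y2') <= W + K * h ^+ 2 * W.
    by move: Va; rewrite -/W mulrDl mul1r.
  have E : p * (x1' + h * ((1 + eta) * y1' + (eta ^+ 2 + eta))) +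
      (x2' + h * ((1 + eta) * y2' + (eta ^+ 2 + eta))) =
    p * x1' + x2' + h * (p * y1' + y2') + q * (p * y1' + y2') +
    h * (p + 1) * (eta ^+ 2 + eta).
    by rewrite /q; ring.
  lra.
rewrite -/q in eh0 *.
have pp : 0 <= p + 1 by rewrite addr_ge0// ltW.
have K4 : 0 <= 1 + 4 * K by rewrite addr_ge0// mulr_ge0.
have G1 : (1 + q) * (p * n1 + n2) <= (1 + q) * ((1 + 2 * K * q) * W + 2 * q * (p + 1)).
  by rewrite ler_wpM2l//; lra.
have q2 : q ^+ 2 <= q by rewrite expr2 ler_piMl// ltW.
have G2 : 2 * K * W * q ^+ 2 <= 2 * K * W * q by rewrite ler_wpM2l// !mulr_ge0.
have G3 : 6 * (p + 1) * q ^+ 2 <= 6 * (p + 1) * q by rewrite ler_wpM2l// mulr_ge0.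
(* Origin of the constant: after multiplication by [1 + q] and use of [q ^+ 2 <= q], the coefficient
   of [q * W] is [1 + 4 * K] and the additive term is [12 * (p + 1) * q]. *)
have G4 : (1 + (1 + 4 * K + 12 * (p + 1)) * q) * (W + 1) <=
    (1 + (1 + 4 * K + 12 * (p + 1)) * q) * (v + 1).
  rewrite ler_wpM2l ?lerD2r// addr_ge0// mulr_ge0 ?(ltW eh0)//.
  by rewrite addr_ge0// mulr_ge0.
apply: le_trans G4.
have G5 : 0 <= 12 * (p + 1) * q * W.
  by do ?[exact: W0|exact: pp|exact: ltW|apply: mulr_ge0].
have G6 : 0 <= (1 + 4 * K) * q by apply: mulr_ge0 => //; exact: ltW.
have -> : p * ((1 + q) * n1 + (4 * q ^+ 2 + 4 * q)) +
    ((1 + q) * n2 + (4 * q ^+ 2 + 4 * q)) + 1 =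
  (1 + q) * (p * n1 + n2) + (p + 1) * (4 * q ^+ 2 + 4 * q) + 1 by ring.
have E7 : (1 + q) * ((1 + 2 * K * q) * W + 2 * q * (p + 1)) +
    (p + 1) * (4 * q ^+ 2 + 4 * q) =
  W + q * W + 2 * (K * W * q) + 2 * K * W * q ^+ 2 +
    6 * (p + 1) * q ^+ 2 + 6 * (p + 1) * q by ring.
have E8 : (1 + (1 + 4 * K + 12 * (p + 1)) * q) * (W + 1) =
  W + q * W + 4 * (K * W * q) + 12 * (p + 1) * q * W + 1 +
    (1 + 4 * K) * q + 12 * (p + 1) * q by ring.
lra.
Qed.

End euler.

Section measurable_wrt_closure.
Context {R : realType} {d : measure_display} {T : measurableType d}.
Context (F : filtration R T) (t : R).
Hypothesis t0 : 0 <= t.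

Lemma measurable_wrtD (X Y : T -> R) : measurable_wrt (F t) X ->
  measurable_wrt (F t) Y -> measurable_wrt (F t) (fun w => X w + Y w).
Proof.
move=> /(measurable_wrtP _ _ t0) mX /(measurable_wrtP _ _ t0) mY.
by apply/measurable_wrtP => //; exact: measurable_funD.
Qed.

Lemma measurable_wrtM (X Y : T -> R) : measurable_wrt (F t) X ->
  measurable_wrt (F t) Y -> measurable_wrt (F t) (fun w => X w * Y w).
Proof.
move=> /(measurable_wrtP _ _ t0) mX /(measurable_wrtP _ _ t0) mY.
by apply/measurable_wrtP => //; exact: measurable_funM.
Qed.

Lemma measurable_wrtB (X Y : T -> R) : measurable_wrt (F t) X ->
  measurable_wrt (F t) Y -> measurable_wrt (F t) (fun w => X w - Y w).
Proof.
move=> /(measurable_wrtP _ _ t0) mX /(measurable_wrtP _ _ t0) mY.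
by apply/measurable_wrtP => //; exact: measurable_funB.
Qed.

Lemma measurable_wrt_clip (e : R) (X : T -> R) : measurable_wrt (F t) X ->
  measurable_wrt (F t) (fun w => clip e (X w)).
Proof.
move=> /(measurable_wrtP _ _ t0) mX.
by apply/measurable_wrtP => //; exact: measurable_fun_clip.
Qed.

Lemma measurable_wrt_linear (a b : R) (X Y : T -> R) : measurable_wrt (F t) X ->
  measurable_wrt (F t) Y -> measurable_wrt (F t) (fun w => a * X w + b * Y w).
Proof.
by move=> mX mY; apply: measurable_wrtD; apply: measurable_wrtM => //;
  exact: measurable_wrt_cst.
Qed.

End measurable_wrt_closure.

Lemma linear_oscillation {R : realType} (a b x y x' y' c : R) :
  `|x - x'| <= c -> `|y - y'| <= c ->
  `|(a * x + b * y) - (a * x' + b * y')| <= (`|a| + `|b|) * c.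
Proof.
move=> hx hy.
have -> : a * x + b * y - (a * x' + b * y') = a * (x - x') + b * (y - y') by ring.
apply: le_trans (ler_normD _ _) _; rewrite !normrM mulrDl.
by apply: lerD; apply: ler_wpM2l.
Qed.

(** Inverts [1 - x <= expR (- x)]; up to one half, [(1 - x) (1 + 2 x) = 1 + x (1 - 2 x)] is at least
    1. *)
Lemma expR_le_1D2x {R : realType} (x : R) : 0 <= x -> x <= 2^-1 -> expR x <= 1 + 2 * x.
Proof.
move=> x0 x1.
have h : 1 - x <= expR (- x) by exact: expR_ge1Dx.
have h1 : 0 < 1 - x by lra.
have h2 : expR x <= (1 - x)^-1.
  by rewrite -[x in leLHS]opprK expRN lef_pV2 ?posrE ?expR_gt0.
apply: (le_trans h2); rewrite -[leLHS]mul1r ler_pdivrMr//.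
have : 0 <= x * (1 - 2 * x) by rewrite mulr_ge0//; lra.
by nra.
Qed.

(** * From one Euler step to all times *)

Section lyapunov.
Context {R : realType} {d : measure_display} {T : measurableType d}.
Context (P : probability T R) (F : filtration R T) (B : R -> T -> R).
Hypothesis hB : wiener P F B.
Variables (a11 a12 a21 a22 b11 b12 b21 b22 p K : R).
Let f1 (x y : R) := a11 * x + a12 * y.
Let f2 (x y : R) := a21 * x + a22 * y.
Let g1 (x y : R) := b11 * x + b12 * y.
Let g2 (x y : R) := b21 * x + b22 * y.
Hypothesis p0 : 0 < p.
Hypothesis K0 : 0 <= K.
Hypothesis lyapunov : forall x y,
  2 * (p * x * f1 x y + y * f2 x y) + (p * g1 x y ^+ 2 + g2 x y ^+ 2) <= 0.
Hypothesis Kf : forall x y, p * f1 x y ^+ 2 + f2 x y ^+ 2 <= K * (p * x ^+ 2 + y ^+ 2).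
Hypothesis Kg : forall x y, p * g1 x y ^+ 2 + g2 x y ^+ 2 <= K * (p * x ^+ 2 + y ^+ 2).

Let C := 1 + 4 * K + 12 * (p + 1).

Section approximation.

(** A common Lipschitz constant of the four linear coefficients, with 1 added for positivity: if
    [u1] and [u2] oscillate by at most [eta / L], every coefficient oscillates by at most [eta]. *)
Let L := 1 + `|a11| + `|a12| + `|a21| + `|a22| + `|b11| + `|b12| + `|b21| + `|b22|.

Variables (u1 u2 : R -> T -> R).
Hypothesis sol : ito_solution P F B f1 f2 g1 g2 u1 u2.
Variables (M eta eps : R).
Hypothesis M0 : 0 < M.
Hypothesis eta0 : 0 < eta.
Hypothesis eta1 : eta <= 1.
Hypothesis eps0 : 0 < eps.

(* [(Z1, Z2)] is the last point of an Euler scheme to which the truncated parts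
   of the true increments are added; off [N] the truncations are inactive and
   the scheme reproduces the solution exactly. *)
Lemma euler_approximation (v0 : R) :
  (p%:E * second_moment P (u1 0%R) + second_moment P (u2 0%R) <= v0%:E)%E ->
  exists (Z1 Z2 : T -> R) (N : set T),
  [/\ measurable_fun setT Z1 /\ measurable_fun setT Z2,
      measurable N, (P N <= eps%:E)%E,
      (p%:E * second_moment P Z1 + second_moment P Z2 + 1 <=
         (expR (C * eta * M) * (v0 + 1))%:E)%E &
      forall w, ~ N w -> Z1 w = u1 M w /\ Z2 w = u2 M w].
Proof.
move=> v0E; case: sol => -[au1 au2] [cu1 cu2] itoJ.
have L0 : 0 < L by rewrite /L; do !apply: ltr_pwDl => //.
have Lle (a b : R) : `|a| + `|b| <= L -> forall x y x' y',
    `|x - x'| <= eta / L -> `|y - y'| <= eta / L ->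
    `|(a * x + b * y) - (a * x' + b * y')| <= eta.
  move=> abL x y x' y' hx hy; apply: le_trans (linear_oscillation a b hx hy) _.
  by rewrite mulrC mulrAC ler_pdivrMr// ler_wpM2l// ltW.
have [Lf1 Lf2 Lg1 Lg2] : [/\ `|a11| + `|a12| <= L, `|a21| + `|a22| <= L,
    `|b11| + `|b12| <= L & `|b21| + `|b22| <= L].
  have nn := @normr_ge0 _ R; rewrite /L.
  have := (nn a11, nn a12, nn a21, nn a22, nn b11, nn b12, nn b21, nn b22).
  by move=> [[[[[[[]]]]]]] *; split; lra.
have etaL0 : 0 < eta / L by rewrite divr_gt0.
have eps4 : 0 < eps / 4 by rewrite divr_gt0.
have mu1 t : 0 <= t -> measurable_fun setT (u1 t).
  by move=> t0; exact: measurable_wrt_measurable t0 (au1 t t0).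
have mu2 t : 0 <= t -> measurable_fun setT (u2 t).
  by move=> t0; exact: measurable_wrt_measurable t0 (au2 t t0).
have [del1 [N1 [del10 mN1 PN1 HN1]]] := modulus_of_continuity M mu1 cu1 etaL0 eps4.
have [del2 [N2 [del20 mN2 PN2 HN2]]] := modulus_of_continuity M mu2 cu2 etaL0 eps4.
(* Including [eta] in the minimum provides [h <= eta], which [euler_step] requires. *)
pose del := Num.min (Num.min del1 del2) eta.
have del0 : 0 < del by rewrite !lt_min del10 del20 eta0.
have [m Mm] : exists m : nat, M / m.+1%:R < del.
  exists (Num.truncn (M / del)).
  by rewrite ltr_pdivrMr// -ltr_pdivrMl// mulrC truncnS_gt// divr_ge0 ltW.
pose h := M / m.+1%:R.
have h0 : 0 < h by rewrite divr_gt0.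
have [hd1 hd2 heta] : [/\ h < del1, h < del2 & h <= eta].
  by split; [| |apply: ltW]; apply: lt_le_trans Mm _; rewrite /del !ge_min lexx ?orbT.
pose t (k : nat) := k%:R * h.
have t0 k : 0 <= t k by rewrite mulr_ge0// ltW.
have tS k : t k.+1 - t k = h by rewrite /t -natr1 mulrDl mul1r addrAC subrr add0r.
have lt_t k : t k < t k.+1 by rewrite -subr_gt0 tS.
have tM : t m.+1 = M by rewrite /t /h mulrC divfK.
have t00 : t 0%N = 0 by rewrite /t mul0r.
have le_tM k : (k <= m.+1)%N -> t k <= M.
  by move=> km; rewrite -tM /t ler_wpM2r ?ler_nat// ltW.
have /choice[J HJ] : forall k, exists J : (T -> R) * (T -> R), [/\
    is_ito_integral P F B (fun s w => g1 (u1 s w) (u2 s w)) (t k) J.1,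
    is_ito_integral P F B (fun s w => g2 (u1 s w) (u2 s w)) (t k) J.2,
    {ae P, forall w, u1 (t k) w = u1 0 w +
      \int[lebesgue_measure]_(s in `[0%R, t k]) f1 (u1 s w) (u2 s w) + J.1 w} &
    {ae P, forall w, u2 (t k) w = u2 0 w +
      \int[lebesgue_measure]_(s in `[0%R, t k]) f2 (u1 s w) (u2 s w) + J.2 w}].
  by move=> k; have [J1 [J2 HJ]] := itoJ _ (t0 k); exists (J1, J2).
have [N3 [mN3 PN3 HN3]] : exists N3, [/\ measurable N3, P N3 = 0%E & forall w, ~ N3 w ->
  forall k,
    u1 (t k) w = u1 0 w +
      \int[lebesgue_measure]_(s in `[0%R, t k]) f1 (u1 s w) (u2 s w) + (J k).1 w /\
    u2 (t k) w = u2 0 w +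
      \int[lebesgue_measure]_(s in `[0%R, t k]) f2 (u1 s w) (u2 s w) + (J k).2 w].
  have [N3 [mN3 PN3 sub]] : {ae P, forall w, forall k,
    u1 (t k) w = u1 0 w +
      \int[lebesgue_measure]_(s in `[0%R, t k]) f1 (u1 s w) (u2 s w) + (J k).1 w /\
    u2 (t k) w = u2 0 w +
      \int[lebesgue_measure]_(s in `[0%R, t k]) f2 (u1 s w) (u2 s w) + (J k).2 w}.
    apply/ae_foralln => k; have [_ _ h1 h2] := HJ k.
    by apply: filterS2 h1 h2.
  exists N3; split => // w nN k; apply: contrapT => nk; apply: nN; apply: sub.
  by move=> /(_ k).
(* The two moduli of continuity use [eps / 4] each; the other half of [eps] is shared by the
   [2 * m.+1] exceptional events of the Ito increments. *)
pose e' := eps / 4 / m.+1%:R.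
have e'0 : 0 < e' by rewrite divr_gt0.
have kap0 : 0 < eta * h by rewrite mulr_gt0.
have /choice[rN1 HrN1] k : exists rN : (T -> R) * set T,
  [/\ measurable_wrt (F (t k.+1)) rN.1,
      forall X phi : T -> R, measurable_wrt (F (t k)) X -> measurable_wrt (F (t k)) phi ->
        (second_moment P (fun w => X w + phi w * (B (t k.+1) w - B (t k) w) + rN.1 w)%R <=
         second_moment P X + h%:E *
           ((1 + eta)%:E * second_moment P phi + ((1 + eta^-1) * eta ^+ 2)%:E))%E,
      measurable rN.2, (P rN.2 <= e'%:E)%E &
      forall w, ~ rN.2 w -> (forall r, t k <= r <= t k.+1 ->
         `|g1 (u1 r w) (u2 r w) - g1 (u1 (t k) w) (u2 (t k) w)| <= eta) ->
        `|(J k.+1).1 w - (J k).1 w - g1 (u1 (t k) w) (u2 (t k) w) *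
           (B (t k.+1) w - B (t k) w) - rN.1 w| <= eta * h].
  have [i1 _ _ _] := HJ k; have [i1' _ _ _] := HJ k.+1.
  have [rho [N]] := ito_increment hB (t0 k) (lt_t k) eta0 kap0 e'0 i1 i1'.
  by rewrite tS => H; exists (rho, N).
have /choice[rN2 HrN2] k : exists rN : (T -> R) * set T,
  [/\ measurable_wrt (F (t k.+1)) rN.1,
      forall X phi : T -> R, measurable_wrt (F (t k)) X -> measurable_wrt (F (t k)) phi ->
        (second_moment P (fun w => X w + phi w * (B (t k.+1) w - B (t k) w) + rN.1 w)%R <=
         second_moment P X + h%:E *
           ((1 + eta)%:E * second_moment P phi + ((1 + eta^-1) * eta ^+ 2)%:E))%E,
      measurable rN.2, (P rN.2 <= e'%:E)%E &
      forall w, ~ rN.2 w -> (forall r, t k <= r <= t k.+1 ->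
         `|g2 (u1 r w) (u2 r w) - g2 (u1 (t k) w) (u2 (t k) w)| <= eta) ->
        `|(J k.+1).2 w - (J k).2 w - g2 (u1 (t k) w) (u2 (t k) w) *
           (B (t k.+1) w - B (t k) w) - rN.1 w| <= eta * h].
  have [_ i2 _ _] := HJ k; have [_ i2' _ _] := HJ k.+1.
  have [rho [N]] := ito_increment hB (t0 k) (lt_t k) eta0 kap0 e'0 i2 i2'.
  by rewrite tS => H; exists (rho, N).
pose dB k w := B (t k.+1) w - B (t k) w.
pose M1 (z : (T -> R) * (T -> R)) k w := z.1 w + h * f1 (z.1 w) (z.2 w) +
  g1 (z.1 w) (z.2 w) * dB k w + (rN1 k).1 w.
pose M2 (z : (T -> R) * (T -> R)) k w := z.2 w + h * f2 (z.1 w) (z.2 w) +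
  g2 (z.1 w) (z.2 w) * dB k w + (rN2 k).1 w.
pose U k : (T -> R) * (T -> R) := (u1 (t k), u2 (t k)).
(* Freezing the drift costs [eta * h] and the Ito remainder another [eta * h], hence the level. The
   correction is computed from the solution, not from the scheme, so it is adapted and bounded
   everywhere, and it restores the solution exactly wherever the truncation is inactive. *)
pose r1 k w := clip (2 * eta * h) (u1 (t k.+1) w - M1 (U k) k w).
pose r2 k w := clip (2 * eta * h) (u2 (t k.+1) w - M2 (U k) k w).
pose Z := nat_rect (fun=> ((T -> R) * (T -> R))%type) (u1 0, u2 0)
  (fun k z => ((fun w => M1 z k w + r1 k w), (fun w => M2 z k w + r2 k w))).
have mM (z : (T -> R) * (T -> R)) k :
    measurable_wrt (F (t k)) z.1 -> measurable_wrt (F (t k)) z.2 ->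
    measurable_wrt (F (t k.+1)) (M1 z k) /\ measurable_wrt (F (t k.+1)) (M2 z k).
  move=> m1 m2; have tk := t0 k.+1.
  have up := measurable_wrt_le (t0 k) (ltW (lt_t k)).
  have {}m1 := up _ _ _ _ m1; have {}m2 := up _ _ _ _ m2.
  have mdB : measurable_wrt (F (t k.+1)) (dB k).
    apply: measurable_wrtB => //; first exact: wiener_measurable hB _ tk.
    by apply: up; exact: wiener_measurable hB _ (t0 k).
  have [mr1 _ _ _ _] := HrN1 k; have [mr2 _ _ _ _] := HrN2 k.
  split; apply: measurable_wrtD => //; apply: measurable_wrtD => //.
  - apply: measurable_wrtD => //; apply: measurable_wrtM => //.
      exact: measurable_wrt_cst.
    exact: measurable_wrt_linear.
  - by apply: measurable_wrtM => //; exact: measurable_wrt_linear.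
  - apply: measurable_wrtD => //; apply: measurable_wrtM => //.
      exact: measurable_wrt_cst.
    exact: measurable_wrt_linear.
  - by apply: measurable_wrtM => //; exact: measurable_wrt_linear.
have mr k : measurable_wrt (F (t k.+1)) (r1 k) /\ measurable_wrt (F (t k.+1)) (r2 k).
  have [mM1 mM2] := mM (U k) k (au1 _ (t0 k)) (au2 _ (t0 k)).
  by split; apply: measurable_wrt_clip => //; apply: measurable_wrtB => //;
    [exact: au1|exact: au2].
have mZ k : measurable_wrt (F (t k)) (Z k).1 /\ measurable_wrt (F (t k)) (Z k).2.
  elim: k => [|k [IH1 IH2]].
    by rewrite t00; split; [exact: au1|exact: au2].
  have [mM1 mM2] := mM (Z k) k IH1 IH2; have [mr1 mr2] := mr k.
  by split; apply: measurable_wrtD.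
pose q := eta * h.
have EZ k : (p%:E * second_moment P (Z k).1 + second_moment P (Z k).2 + 1 <=
    ((1 + C * q) ^+ k * (v0 + 1))%:E)%E.
  elim: k => [|k IH].
    by rewrite expr0 mul1r EFinD; apply: leeD.
  have [mz1 mz2] := mZ k; have [mM1 mM2] := mM (Z k) k mz1 mz2; have [mr1 mr2] := mr k.
  have toT k' (X : T -> R) := @measurable_wrt_measurable _ _ _ F (t k') X (t0 k').
  have ma1 : measurable_wrt (F (t k))
      (fun w => (Z k).1 w + h * f1 ((Z k).1 w) ((Z k).2 w)).
    apply: measurable_wrtD => //; apply: measurable_wrtM => //.
      exact: measurable_wrt_cst.
    exact: measurable_wrt_linear.
  have ma2 : measurable_wrt (F (t k))
      (fun w => (Z k).2 w + h * f2 ((Z k).1 w) ((Z k).2 w)).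
    apply: measurable_wrtD => //; apply: measurable_wrtM => //.
      exact: measurable_wrt_cst.
    exact: measurable_wrt_linear.
  have mg1 : measurable_wrt (F (t k)) (fun w => g1 ((Z k).1 w) ((Z k).2 w)).
    exact: measurable_wrt_linear.
  have mg2 : measurable_wrt (F (t k)) (fun w => g2 ((Z k).1 w) ((Z k).2 w)).
    exact: measurable_wrt_linear.
  have [_ H1 _ _ _] := HrN1 k; have [_ H2 _ _ _] := HrN2 k.
  have c0 : 0 <= 2 * eta * h by rewrite mulr_ge0 ?(ltW h0)// mulr_ge0// ltW.
  have b1 w : `|r1 k w| <= 2 * eta * h by exact: clip_bound.
  have b2 w : `|r2 k w| <= 2 * eta * h by exact: clip_bound.
  have Hv : (p%:E * second_moment P (Z k).1 + second_moment P (Z k).2 <=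
      ((1 + C * q) ^+ k * (v0 + 1) - 1)%:E)%E.
    by rewrite EFinB leeBrDr.
  have := euler_step p0 K0 lyapunov Kf Kg h0 heta eta1 (toT _ _ mz1) (toT _ _ mz2)
    (toT _ _ mM1) (toT _ _ mM2) (toT _ _ mr1) (toT _ _ mr2) b1 b2
    (H1 _ _ ma1 mg1) (H2 _ _ ma2 mg2) Hv.
  by rewrite -/C -/q subrK mulrA -exprS.
have hm : h * m.+1%:R = M by rewrite /h divfK.
exists (Z m.+1).1, (Z m.+1).2,
  (N1 `|` N2 `|` N3 `|` \big[setU/set0]_(k < m.+1) ((rN1 k).2 `|` (rN2 k).2)).
have mN12 k : measurable ((rN1 k).2 `|` (rN2 k).2).
  by have [_ _ h1 _ _] := HrN1 k; have [_ _ h2 _ _] := HrN2 k; exact: measurableU.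
have mNs : measurable (\big[setU/set0]_(k < m.+1) ((rN1 k).2 `|` (rN2 k).2)).
  exact: bigsetU_measurable.
have C0 : 0 <= C by rewrite /C !addr_ge0 ?mulr_ge0// addr_ge0// ltW.
have q0 : 0 < q by rewrite mulr_gt0.
split.
- have [mz1 mz2] := mZ m.+1.
  split; first exact: measurable_wrt_measurable (t0 _) mz1.
  exact: measurable_wrt_measurable (t0 _) mz2.
- by do 3?apply: measurableU.
- have -> : eps = eps / 4 + eps / 4 + 0 + (eps / 4 + eps / 4) by field.
  apply: probability_setU_le => //; first by do 2?apply: measurableU.
    apply: probability_setU_le => //; first exact: measurableU.
      exact: probability_setU_le.
    by rewrite PN3.
  have -> : eps / 4 + eps / 4 = m.+1%:R * (e' + e').
    have : m.+1%:R != 0 :> R by rewrite pnatr_eq0.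
    by rewrite /e'; move: (m.+1%:R) => z z0; field.
  have : forall n, (P (\big[setU/set0]_(k < n) ((rN1 k).2 `|` (rN2 k).2)) <=
      (n%:R * (e' + e'))%:E)%E.
    elim=> [|n IH]; first by rewrite big_ord0 measure0 mul0r.
    rewrite big_ord_recr/= -natr1 mulrDl mul1r.
    apply: probability_setU_le => //; first exact: bigsetU_measurable.
    have [_ _ h1 h1' _] := HrN1 n; have [_ _ h2 h2' _] := HrN2 n.
    exact: probability_setU_le.
  exact.
- apply: le_trans (EZ m.+1) _; rewrite lee_fin.
  have v00 : 0 <= v0 + 1.
    rewrite -lee_fin EFinD; apply: adde_ge0 => //; apply: le_trans v0E.
    by rewrite adde_ge0 ?mule_ge0 ?second_moment_ge0// lee_fin ltW.
  apply: ler_wpM2r => //.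
  have -> : C * eta * M = m.+1%:R * (C * q) by rewrite -hm /q; ring.
  rewrite expRM_natl; apply: lerXn2r; rewrite ?nnegrE.
  + by rewrite addr_ge0// mulr_ge0// ltW.
  + exact: expR_ge0.
  + exact: expR_ge1Dx.
- move=> w Nw.
  have nN1 : ~ N1 w by move=> hw; apply: Nw; do 3 left.
  have nN2 : ~ N2 w by move=> hw; apply: Nw; do 2 left; right.
  have nN3 : ~ N3 w by move=> hw; apply: Nw; left; right.
  have nNk k : (k < m.+1)%N -> ~ (rN1 k).2 w /\ ~ (rN2 k).2 w.
    have sup := @bigsetU_sup _ k m.+1 (fun k => (rN1 k).2 `|` (rN2 k).2).
    by move=> /sup{}sup; split => hw; apply: Nw; right; apply: sup; [left|right].
  have [c1 osc1] := HN1 w nN1; have [c2 osc2] := HN2 w nN2.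
  have E3 := HN3 w nN3.
  (* As long as the scheme sits on the solution, its next increment is built from the same values,
     so agreement propagates along the grid from the common initial point. *)
  have ZE k : (k <= m.+1)%N -> (Z k).1 w = u1 (t k) w /\ (Z k).2 w = u2 (t k) w.
    elim: k => [|k IH] km; first by rewrite t00.
    have [Z1E Z2E] := IH (ltnW km).
    have [nk1 nk2] := nNk k km.
    have osc r : t k <= r <= t k.+1 ->
        `|u1 r w - u1 (t k) w| <= eta / L /\ `|u2 r w - u2 (t k) w| <= eta / L.
      move=> /andP[r1' r2'].
      have r0M : 0 <= r <= M.
        by rewrite (le_trans (t0 k) r1') (le_trans r2')// le_tM.
      have tk0M : 0 <= t k <= M by rewrite t0 le_tM// ltnW.
      have rt : `|r - t k| <= h by rewrite -(tS k) ger0_norm ?lerD2r// subr_ge0.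
      by split; [apply: osc1|apply: osc2] => //; apply: le_lt_trans rt _.
    have [_ _ _ _ G1] := HrN1 k; have [_ _ _ _ G2] := HrN2 k.
    have {}G1 := G1 w nk1 (fun r hr => Lle _ _ Lg1 _ _ _ _ (osc r hr).1 (osc r hr).2).
    have {}G2 := G2 w nk2 (fun r hr => Lle _ _ Lg2 _ _ _ _ (osc r hr).1 (osc r hr).2).
    have cf (a b : R) : {within `[0, +oo[, continuous (fun r => a * u1 r w + b * u2 r w)}.
      move=> x; apply: cvgD; apply: cvgM;
        [exact: cvg_cst|exact: c1|exact: cvg_cst|exact: c2].
    have D1 := Rintegral_increment (cf a11 a12) (t0 k) (lt_t k)
      (fun r hr => Lle _ _ Lf1 _ _ _ _ (osc r hr).1 (osc r hr).2).
    have D2 := Rintegral_increment (cf a21 a22) (t0 k) (lt_t k)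
      (fun r hr => Lle _ _ Lf2 _ _ _ _ (osc r hr).1 (osc r hr).2).
    rewrite tS in D1; rewrite tS in D2.
    have [e1 e2] := E3 k; have [e1' e2'] := E3 k.+1.
    have R1 : `|u1 (t k.+1) w - M1 (U k) k w| <= 2 * eta * h.
      have -> : 2 * eta * h = eta * h + eta * h by ring.
      have -> : u1 (t k.+1) w - M1 (U k) k w =
        (\int[lebesgue_measure]_(s in `[0%R, t k.+1]) f1 (u1 s w) (u2 s w) -
         \int[lebesgue_measure]_(s in `[0%R, t k]) f1 (u1 s w) (u2 s w) -
         h * f1 (u1 (t k) w) (u2 (t k) w)) +
        ((J k.+1).1 w - (J k).1 w - g1 (u1 (t k) w) (u2 (t k) w) * dB k w - (rN1 k).1 w).
        by rewrite /M1 /= e1' [u1 (t k) w in X in _ - (X + _ + _ + _)]e1; ring.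
      by apply: le_trans (ler_normD _ _) _; exact: lerD.
    have R2 : `|u2 (t k.+1) w - M2 (U k) k w| <= 2 * eta * h.
      have -> : 2 * eta * h = eta * h + eta * h by ring.
      have -> : u2 (t k.+1) w - M2 (U k) k w =
        (\int[lebesgue_measure]_(s in `[0%R, t k.+1]) f2 (u1 s w) (u2 s w) -
         \int[lebesgue_measure]_(s in `[0%R, t k]) f2 (u1 s w) (u2 s w) -
         h * f2 (u1 (t k) w) (u2 (t k) w)) +
        ((J k.+1).2 w - (J k).2 w - g2 (u1 (t k) w) (u2 (t k) w) * dB k w - (rN2 k).1 w).
        by rewrite /M2 /= e2' [u2 (t k) w in X in _ - (X + _ + _ + _)]e2; ring.
      by apply: le_trans (ler_normD _ _) _; exact: lerD.
    have MZ1 : M1 (Z k) k w = M1 (U k) k w by rewrite /M1 Z1E Z2E.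
    have MZ2 : M2 (Z k) k w = M2 (U k) k w by rewrite /M2 Z1E Z2E.
    split.
      by transitivity (M1 (Z k) k w + r1 k w) => //; rewrite MZ1 /r1 clip_id//; ring.
    by transitivity (M2 (Z k) k w + r2 k w) => //; rewrite MZ2 /r2 clip_id//; ring.
  by rewrite -tM; exact: ZE.
Qed.

End approximation.

(** Off [N] the integrand is at most [V(Z1, Z2)], and on [N] at most [c]. Truncation is what makes
    the event negligible, since nothing is known yet about the integrability of [V(u(M))]. *)
Lemma lyapunov_truncated (u1 u2 : R -> T -> R) (M v0 c : R) :
  ito_solution P F B f1 f2 g1 g2 u1 u2 -> 0 < M -> 0 <= c ->
  (p%:E * second_moment P (u1 0%R) + second_moment P (u2 0%R) <= v0%:E)%E ->
  (\int[P]_w (Num.min c (p * u1 M w ^+ 2 + u2 M w ^+ 2))%:E <= v0%:E)%E.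
Proof.
move=> sol M0 c0 v0E.
have [[au1 au2] _ _] := sol.
have mu1 : measurable_fun setT (u1 M).
  exact: measurable_wrt_measurable (ltW M0) (au1 _ (ltW M0)).
have mu2 : measurable_fun setT (u2 M).
  exact: measurable_wrt_measurable (ltW M0) (au2 _ (ltW M0)).
have v00 : 0 <= v0.
  rewrite -lee_fin; apply: le_trans v0E.
  by rewrite adde_ge0 ?mule_ge0 ?second_moment_ge0// lee_fin ltW.
apply/lee_addgt0Pr => e e0.
have C0 : 0 < C by rewrite /C; have := p0; have := K0; lra.
have CM0 : 0 < C * M by rewrite mulr_gt0.
(* Half of [e] pays for growth: [eta] ensures [C * eta * M <= x], the exponential is at most
   [1 + 2 * x], and [2 * x * (v0 + 1) <= e / 2]. The other half pays for [c * eps]; [c + 1] avoids a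
   zero denominator. *)
pose x := Num.min 2^-1 (e / (4 * (v0 + 1))).
have x0 : 0 < x by rewrite lt_min invr_gt0 ltr0n/= divr_gt0// mulr_gt0//; lra.
have x1 : x <= 2^-1 by rewrite /x ge_min lexx.
have x2 : x * (4 * (v0 + 1)) <= e.
  by rewrite -ler_pdivlMr ?ge_min ?lexx ?orbT// mulr_gt0//; lra.
pose eta := Num.min 1 (x / (C * M)).
have eta0 : 0 < eta by rewrite lt_min ltr01 divr_gt0.
have eta1 : eta <= 1 by rewrite ge_min lexx.
have etax : C * eta * M <= x.
  by rewrite mulrAC mulrC -ler_pdivlMr// ge_min lexx orbT.
pose eps := e / (2 * (c + 1)).
have eps0 : 0 < eps by rewrite divr_gt0// mulr_gt0//; lra.
have [Z1 [Z2 [N [[mZ1 mZ2] mN PN EZ ZE]]]] :=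
  euler_approximation sol M0 eta0 eta1 eps0 v0E.
have V0 (a b : R) : 0 <= p * a ^+ 2 + b ^+ 2.
  by rewrite addr_ge0 ?sqr_ge0// mulr_ge0 ?sqr_ge0// ltW.
have mV (X Y : T -> R) : measurable_fun setT X -> measurable_fun setT Y ->
    measurable_fun setT (fun w => (p * X w ^+ 2 + Y w ^+ 2)).
  move=> mX mY; apply/measurable_funD; last exact: measurable_funX.
  by apply: measurable_funM => //; exact: measurable_funX.
apply: (@le_trans _ _ (\int[P]_w ((p * Z1 w ^+ 2 + Z2 w ^+ 2)%:E + (c * \1_N w)%:E))%E).
  apply: ge0_le_integral => //.
  - by move=> w _; rewrite lee_fin le_min c0 V0.
  - by apply/measurable_EFinP; apply: (measurable_minr (f := cst c)) => //; exact: mV.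
  - apply: emeasurable_funD; apply/measurable_EFinP; first exact: mV.
    by apply: measurable_funM => //; exact: measurable_indic.
  - move=> w _; rewrite -EFinD lee_fin indicE.
    have [wN|wN] := boolP (w \in N).
      by rewrite mulr1 ge_min lerDr V0.
    rewrite mulr0 addr0; have [-> ->] : Z1 w = u1 M w /\ Z2 w = u2 M w.
      by apply: ZE => h; move: wN; rewrite notin_setE.
    by rewrite ge_min lexx orbT.
rewrite ge0_integralD//=; last 4 first.
- by move=> w _; rewrite lee_fin.
- by apply/measurable_EFinP; exact: mV.
- by move=> w _; rewrite lee_fin mulr_ge0.
- by apply/measurable_EFinP; apply: measurable_funM => //; exact: measurable_indic.
rewrite second_moment_lincomb ?(ltW p0)//.
have EN : (\int[P]_w (c * \1_N w)%:E <= (c * eps)%:E)%E.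
  under eq_integral do rewrite EFinM.
  rewrite ge0_integralZl//=; last by apply/measurable_EFinP; exact: measurable_indic.
  by rewrite integral_indic// setIT EFinM lee_wpmul2l.
have -> : (v0%:E + e%:E = (v0 + e / 2)%:E + (e / 2)%:E)%E.
  by rewrite -!EFinD -addrA -splitr.
apply: leeD; last first.
  apply: le_trans EN _; rewrite lee_fin /eps.
  rewrite mulrA ler_pdivrMr; last by rewrite mulr_gt0//; lra.
  by rewrite mulrC; have := e0; nra.
rewrite -(@leeD2rE _ 1%E)//; apply: le_trans EZ _; rewrite -EFinD lee_fin.
have h1 : expR (C * eta * M) <= 1 + 2 * x.
  apply: (@le_trans _ _ (expR x)); first by rewrite ler_expR.
  by apply: expR_le_1D2x => //; exact: ltW.
have h2 : expR (C * eta * M) * (v0 + 1) <= (1 + 2 * x) * (v0 + 1).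
  by rewrite ler_wpM2r//; lra.
by apply: le_trans h2 _; lra.
Qed.

(** Monotone convergence removes the truncation. Finiteness of the second moments at time [M] is
    thus a conclusion, inherited from time 0; an infinite initial value makes the bound trivial. *)
Lemma lyapunov_second_moment (u1 u2 : R -> T -> R) (M : R) :
  ito_solution P F B f1 f2 g1 g2 u1 u2 -> 0 <= M ->
  (p%:E * second_moment P (u1 M) + second_moment P (u2 M) <=
   p%:E * second_moment P (u1 0%R) + second_moment P (u2 0%R))%E.
Proof.
move=> sol; rewrite le_eqVlt => /predU1P[<-//|M0].
set V0 := (p%:E * second_moment P (u1 0%R) + second_moment P (u2 0%R))%E.
have V0_ge0 : (0 <= V0)%E.
  by rewrite adde_ge0 ?mule_ge0 ?second_moment_ge0// lee_fin ltW.
have [->|V0oo] := eqVneq V0 +oo%E; first exact: leey.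
have fV0 : V0 \is a fin_num by rewrite ge0_fin_numE// lt_neqAle V0oo leey.
have trunc c : 0 <= c ->
    (\int[P]_w (Num.min c (p * u1 M w ^+ 2 + u2 M w ^+ 2))%:E <= V0)%E.
  move=> c0; rewrite -(fineK fV0); apply: (lyapunov_truncated sol) => //.
  by rewrite fineK.
have [[au1 au2] _ _] := sol.
have mu1 : measurable_fun setT (u1 M).
  exact: measurable_wrt_measurable (ltW M0) (au1 _ (ltW M0)).
have mu2 : measurable_fun setT (u2 M).
  exact: measurable_wrt_measurable (ltW M0) (au2 _ (ltW M0)).
rewrite -second_moment_lincomb ?(ltW p0)//.
have V_ge0 (a b : R) : 0 <= p * a ^+ 2 + b ^+ 2.
  by rewrite addr_ge0 ?sqr_ge0// mulr_ge0 ?sqr_ge0// ltW.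
have mV : measurable_fun setT (fun w => (p * u1 M w ^+ 2 + u2 M w ^+ 2)).
  apply/measurable_funD; last exact: measurable_funX.
  by apply: measurable_funM => //; exact: measurable_funX.
pose g n w := (Num.min n%:R (p * u1 M w ^+ 2 + u2 M w ^+ 2))%:E.
have limg w : g n w @[n --> \oo] --> (p * u1 M w ^+ 2 + u2 M w ^+ 2)%:E.
  apply: cvg_near_cst; near=> n; rewrite /g min_r//.
  by near: n; exact: nbhs_infty_ger.
have mg n : measurable_fun setT (g n).
  by apply/measurable_EFinP; apply: (measurable_minr (f := cst n%:R)).
have -> : (\int[P]_w (p * u1 M w ^+ 2 + u2 M w ^+ 2)%:E = \int[P]_w limn (g ^~ w))%E.
  by apply: eq_integral => w _; apply/esym/cvg_lim.
rewrite monotone_convergence//.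
- apply: lime_le; last by apply: nearW => n; exact: trunc.
  apply: ereal_nondecreasing_is_cvgn => n n' nn'; apply: ge0_le_integral => //.
  + by move=> w _; rewrite lee_fin le_min V_ge0 ler0n.
  + move=> w _; rewrite lee_fin le_min !ge_min lexx orbT andbT.
    by rewrite ler_nat nn'.
- by move=> n w _; rewrite lee_fin le_min V_ge0 ler0n.
- move=> w _ n n' nn'; rewrite lee_fin le_min !ge_min lexx orbT andbT.
  by rewrite ler_nat nn'.
Unshelve. all: by end_near. Qed.

End lyapunov.

(** * Stability *)

Lemma linear_form_sqr_le {R : realFieldType} (a b x y : R) :
  (a * x + b * y) ^+ 2 <= (a ^+ 2 + b ^+ 2) * (x ^+ 2 + y ^+ 2).
Proof.
rewrite -subr_ge0.
have -> : (a ^+ 2 + b ^+ 2) * (x ^+ 2 + y ^+ 2) - (a * x + b * y) ^+ 2 =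
  (a * y - b * x) ^+ 2 by ring.
exact: sqr_ge0.
Qed.

Theorem proposition8 (R : realType) (d : measure_display)
    (T : measurableType d) (P : probability T R) (F : filtration R T)
    (B : R -> T -> R) (hB : wiener P F B)
    (c1 c2 k1 k2 : R) (hc1 : 0 < c1) (hc2 : 0 < c2) (hk1 : 0 < k1) (hk2 : 0 < k2)
    (b11 b12 b21 b22 : R) :
  let a11 := - 2 * k1 * c1 * (c1 + c2) in
  let a12 := - k1 * (c1 ^+ 2 - c2 ^+ 2) in
  let a21 := k2 * (c1 ^+ 2 - c2 ^+ 2) in
  let a22 := - 2 * k2 * c2 * (c1 + c2) in
  a12 + b11 * b12 != 0 ->
  let A1 := (a21 + b21 * b22) / (a12 + b11 * b12) in
  let q1 := (a11 + 2^-1 * b11 ^+ 2) * A1 - 2^-1 * b21 ^+ 2 in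
  let q2 := - a22 - 2^-1 * b22 ^+ 2 + 2^-1 * b12 ^+ 2 * A1 in
  A1 < 0 -> 0 < q1 -> 0 < q2 ->
  mean_square_stable P F B
    (fun x y => a11 * x + a12 * y) (fun x y => a21 * x + a22 * y)
    (fun x y => b11 * x + b12 * y) (fun x y => b21 * x + b22 * y).
Proof.
move=> a11 a12 a21 a22 nz A1 q1 q2 A10 q10 q20 e e0.
pose p := - A1.
have p0 : 0 < p by rewrite oppr_gt0.
have A1E : A1 * (a12 + b11 * b12) = a21 + b21 * b22 by rewrite /A1 divfK.
have lyap (x y : R) : 2 * (p * x * (a11 * x + a12 * y) + y * (a21 * x + a22 * y)) +
    (p * (b11 * x + b12 * y) ^+ 2 + (b21 * x + b22 * y) ^+ 2) <= 0.
  (* With weight [p = - A1], the coefficient of [x * y] vanishes precisely because [A1] solves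
     [A1 * (a12 + b11 * b12) = a21 + b21 * b22]; the quadratic form becomes diagonal, with entries
     [- 2 * q1] and [- 2 * q2]. *)
  have -> : 2 * (p * x * (a11 * x + a12 * y) + y * (a21 * x + a22 * y)) +
      (p * (b11 * x + b12 * y) ^+ 2 + (b21 * x + b22 * y) ^+ 2) =
      - (2 * q1 * x ^+ 2 + 2 * q2 * y ^+ 2) +
      2 * (a21 + b21 * b22 - A1 * (a12 + b11 * b12)) * x * y.
    by rewrite /p /q1 /q2; field.
  rewrite A1E subrr mulr0 !mul0r addr0 oppr_le0 addr_ge0//.
    by rewrite mulr_ge0 ?sqr_ge0// mulr_ge0// ltW.
  by rewrite mulr_ge0 ?sqr_ge0// mulr_ge0// ltW.
(* [V] is equivalent to the squared Euclidean norm, with [lo] and [hi] as the optimal constants. *)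
pose lo := Num.min 1 p; pose hi := Num.max 1 p.
have lo0 : 0 < lo by rewrite lt_min ltr01 p0.
have hi0 : 0 < hi by rewrite lt_max ltr01.
have lo_le (x y : R) : lo * (x ^+ 2 + y ^+ 2) <= p * x ^+ 2 + y ^+ 2.
  rewrite mulrDr; apply: lerD.
    by apply: ler_wpM2r; rewrite ?sqr_ge0// ge_min lexx orbT.
  by rewrite -[leRHS]mul1r; apply: ler_wpM2r; rewrite ?sqr_ge0// ge_min lexx.
have hi_ge (x y : R) : p * x ^+ 2 + y ^+ 2 <= hi * (x ^+ 2 + y ^+ 2).
  rewrite mulrDr; apply: lerD.
    by apply: ler_wpM2r; rewrite ?sqr_ge0// le_max lexx orbT.
  by rewrite -[leLHS]mul1r; apply: ler_wpM2r; rewrite ?sqr_ge0// le_max lexx.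
pose S := a11 ^+ 2 + a12 ^+ 2 + a21 ^+ 2 + a22 ^+ 2 +
  b11 ^+ 2 + b12 ^+ 2 + b21 ^+ 2 + b22 ^+ 2.
have S0 : 0 <= S by rewrite /S !addr_ge0 ?sqr_ge0.
(* Cauchy-Schwarz bounds the linear forms by [S] in the Euclidean norm; the factor [hi / lo]
   converts this into a bound in terms of [V]. *)
pose K := hi * S / lo.
have K0 : 0 <= K by rewrite /K divr_ge0 ?(ltW lo0)// mulr_ge0// ltW.
have bound (al be ga de : R) : al ^+ 2 + be ^+ 2 + (ga ^+ 2 + de ^+ 2) <= S ->
    forall x y, p * (al * x + be * y) ^+ 2 + (ga * x + de * y) ^+ 2 <=
      K * (p * x ^+ 2 + y ^+ 2).
  move=> hS x y; apply: le_trans (hi_ge _ _) _.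
  have h1 : (al * x + be * y) ^+ 2 + (ga * x + de * y) ^+ 2 <= S * (x ^+ 2 + y ^+ 2).
    apply: le_trans (lerD (linear_form_sqr_le _ _ _ _) (linear_form_sqr_le _ _ _ _)) _.
    by rewrite -mulrDl ler_wpM2r// addr_ge0 ?sqr_ge0.
  apply: (@le_trans _ _ (hi * (S * (x ^+ 2 + y ^+ 2)))).
    by rewrite ler_wpM2l// ltW.
  have -> : K * (p * x ^+ 2 + y ^+ 2) = hi * (S * ((p * x ^+ 2 + y ^+ 2) / lo)).
    by rewrite /K; field; rewrite gt_eqF.
  rewrite ler_wpM2l ?(ltW hi0)// ler_wpM2l// ler_pdivlMr// mulrC.
  exact: lo_le.
have ss := @sqr_ge0 R.
have Kf := bound a11 a12 a21 a22.
have Kg := bound b11 b12 b21 b22.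
have {}Kf : forall x y, p * (a11 * x + a12 * y) ^+ 2 +
    (a21 * x + a22 * y) ^+ 2 <= K * (p * x ^+ 2 + y ^+ 2).
  by apply: Kf; rewrite /S; have := (ss b11, ss b12, ss b21, ss b22); move=> [[[]]]; lra.
have {}Kg : forall x y, p * (b11 * x + b12 * y) ^+ 2 +
    (b21 * x + b22 * y) ^+ 2 <= K * (p * x ^+ 2 + y ^+ 2).
  by apply: Kg; rewrite /S; have := (ss a11, ss a12, ss a21, ss a22); move=> [[[]]]; lra.
(* This [delta] comes from the chain [lo E|u(t)|^2 <= E V(u(t)) <= E V(u(0)) <= hi E|u(0)|^2]. *)
exists (lo / hi * e); first by rewrite mulr_gt0// divr_gt0.
move=> u1 u2 sol _ _ ms0 t t0.
have [[au1 au2] _ _] := sol.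
have mu1 s : 0 <= s -> measurable_fun setT (u1 s).
  by move=> s0; exact: measurable_wrt_measurable s0 (au1 s s0).
have mu2 s : 0 <= s -> measurable_fun setT (u2 s).
  by move=> s0; exact: measurable_wrt_measurable s0 (au2 s s0).
have main := lyapunov_second_moment hB p0 K0 lyap Kf Kg sol t0.
rewrite -(second_moment_lincomb P (ltW p0) (mu1 _ t0) (mu2 _ t0)) in main.
rewrite -(second_moment_lincomb P (ltW p0) (mu1 _ (lexx _)) (mu2 _ (lexx _))) in main.
have msE s : mean_square P (u1 s) (u2 s) = (\int[P]_w (u1 s w ^+ 2 + u2 s w ^+ 2)%:E)%E.
  by rewrite /mean_square unlock.
have mq s : 0 <= s -> measurable_fun setT (fun w => (u1 s w ^+ 2 + u2 s w ^+ 2)%:E).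
  move=> s0; apply/measurable_EFinP; apply: measurable_funD; apply: measurable_funX.
    exact: mu1.
  exact: mu2.
have mV s : 0 <= s -> measurable_fun setT (fun w => (p * u1 s w ^+ 2 + u2 s w ^+ 2)%:E).
  move=> s0; apply/measurable_EFinP; apply: measurable_funD; last first.
    by apply: measurable_funX; exact: mu2.
  by apply: measurable_funM => //; apply: measurable_funX; exact: mu1.
have q0 (x y : R) : (0 <= (x ^+ 2 + y ^+ 2)%:E)%E by rewrite lee_fin addr_ge0 ?sqr_ge0.
have low : (lo%:E * mean_square P (u1 t) (u2 t) <=
    \int[P]_w (p * u1 t w ^+ 2 + u2 t w ^+ 2)%:E)%E.
  rewrite msE -ge0_integralZl//=; last 2 first.
  - exact: mq.
  - by rewrite lee_fin ltW.
  apply: ge0_le_integral => //=.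
  - by move=> w _; rewrite mule_ge0// lee_fin ltW.
  - by apply: emeasurable_funM => //; exact: mq.
  - exact: mV.
  - by move=> w _; rewrite -EFinM lee_fin lo_le.
have high : (\int[P]_w (p * u1 0 w ^+ 2 + u2 0 w ^+ 2)%:E <=
    hi%:E * mean_square P (u1 0%R) (u2 0%R))%E.
  rewrite msE -ge0_integralZl//=; last 2 first.
  - exact: mq.
  - by rewrite lee_fin ltW.
  apply: ge0_le_integral => //=.
  - move=> w _; rewrite lee_fin; apply: le_trans (lo_le _ _).
    by rewrite mulr_ge0 ?(ltW lo0)// addr_ge0 ?sqr_ge0.
  - exact: mV.
  - by apply: emeasurable_funM => //; exact: mq.
  - by move=> w _; rewrite -EFinM lee_fin hi_ge.
have : (lo%:E * mean_square P (u1 t) (u2 t) < (lo * e)%:E)%E.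
  apply: (le_lt_trans low); apply: (le_lt_trans main); apply: (le_lt_trans high).
  have -> : (lo * e)%:E = (hi%:E * (lo / hi * e)%:E)%E.
    by rewrite -EFinM; congr EFin; field; rewrite gt_eqF.
  by rewrite lte_pmul2l// lte_fin.
by rewrite EFinM lte_pmul2l// lte_fin.
Qed.
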